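(* Let $\lambda\in\mathbb R$ and $k\ge1$, and set $S=\{1,\dots,2k\}$. Let $\mathbf n_1$ be distributed according to $\mathbb P^S_{n,\lambda}$ and, independently, let $\mathbf n_2$ be distributed according to $\mathbb P^\emptyset_{n,\lambda}$. Let $P^{\mathsf s}_{k,\lambda}$ (resp. $P^{\mathsf d}_{k,\lambda}$) be the projection of $X^{\mathsf s}_{k,\lambda}$ (resp. $X^{\mathsf d}_{k,\lambda}$) on $\mathcal P_{\mathrm{even}}(S)$. Then, as $n\to\infty$, $$\mathfrak P(\mathbf n_1)\longrightarrow P^{\mathsf s}_{k,\lambda},\qquad \mathfrak P(\mathbf n_1+\mathbf n_2)\longrightarrow P^{\mathsf d}_{k,\lambda},$$ where both convergences are in distribution. Moreover, the support of $P^{\mathsf s}_{k,\lambda}$ and of $P^{\mathsf d}_{k,\lambda}$ is equal to $\mathcal P_{\mathrm{even}}(S)$ (i.e. each even partition of $S$ has positive probability).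
   Context: For $n\ge1$ let $K_n$ be the complete graph on $V_n=\{1,\dots,n\}$, with edge set $\mathcal P_2(V_n)$ (the unordered pairs of distinct vertices). For $\lambda\in\mathbb R$ put $d_n(\lambda)=\frac1n\left(1-\frac{\lambda}{\sqrt n}\right)$; $n$ is taken large enough that $d_n(\lambda)>0$ and $S\subset V_n$. A current on $K_n$ is a function $\mathbf n:\mathcal P_2(V_n)\to\mathbb N=\{0,1,2,\dots\}$, written $\{i,j\}\mapsto\mathbf n_{i,j}$; $\Omega_n$ is the set of currents. Its source set is $\partial\mathbf n=\{x\in V_n:\sum_{y\ne x}\mathbf n_{x,y}\text{ is odd}\}$ and its weight is $w(\mathbf n)=\prod_{\{i,j\}\in\mathcal P_2(V_n)}\frac{d_n(\lambda)^{\mathbf n_{i,j}}}{\mathbf n_{i,j}!}$. For $S\subset V_n$ of even cardinality, $Z_n^S(\lambda)=\sum_{\mathbf n\in\Omega_n:\,\partial\mathbf n=S}w(\mathbf n)$, and $\mathbb P^S_{n,\lambda}$ is the probability measure on $\Omega_n$ given by $\mathbb P^S_{n,\lambda}[\mathbf n]=\frac{1}{Z^S_n(\lambda)}w(\mathbf n)\mathbf 1[\partial\mathbf n=S]$. Two vertices $x,y$ are connected in $\mathbf n$ if there is a path from $x$ to $y$ all of whose edges $e$ satisfy $\mathbf n_e>0$; $\mathcal C_x(\mathbf n)$ is the set of vertices connected to $x$ in $\mathbf n$ (including $x$). $\mathcal P_{\mathrm{even}}(S)$ is the set of partitions of $S$ all of whose blocks have even cardinality. For a current $\mathbf n$ with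 $\partial\mathbf n=S$, $\mathfrak P(\mathbf n)\in\mathcal P_{\mathrm{even}}(S)$ is the partition of $S$ in which two elements are in the same block iff they are connected in $\mathbf n$. $X^{\mathsf s}_{k,\lambda}$ and $X^{\mathsf d}_{k,\lambda}$ are the random variables on $(\mathbb R_{\ge0})^{2k}\times\mathcal P_{\mathrm{even}}(S)$ which are the limits in distribution as $n\to\infty$ (these limits exist) of $\left(\frac{|\mathcal C_1(\mathbf m)|}{\sqrt n},\dots,\frac{|\mathcal C_{2k}(\mathbf m)|}{\sqrt n},\mathfrak P(\mathbf m)\right)$ for $\mathbf m=\mathbf n_1$ and $\mathbf m=\mathbf n_1+\mathbf n_2$ respectively. *)

(* Defs.v *)
From HB Require Import structures.
From mathcomp Require Import all_boot all_order all_algebra.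
From mathcomp Require Import all_classical all_reals all_analysis.

Set Implicit Arguments.
Unset Strict Implicit.
Unset Printing Implicit Defensive.

Import Order.TTheory GRing.Theory Num.Theory.
Import numFieldNormedType.Exports.

Local Open Scope classical_set_scope.
Local Open Scope ring_scope.

Definition borel (T : ptopologicalType) := g_sigma_algebraType (@open T).

HB.instance Definition _ (T : ptopologicalType) := Measurable.on (borel T).

HB.instance Definition _ (T U : ptopologicalType) := Pointed.on (T * U)%type.

Lemma continuous_borel (T U : ptopologicalType) (f : T -> U) :
  continuous f -> measurable_fun [set: borel T] (f : borel T -> borel U).
Proof.
move=> /continuousP cf.
apply: (@measurability _ _ (borel T) (borel U) _ _ (@open U)) => //.
move=> _ [B oB <-]; rewrite setTI; apply: sub_sigma_algebra.
exact: cf.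
Qed.

(* The spaces [Om n] carrying the random variables may vary with [n]. *)
Definition cvg_in_distribution (R : realType) (T : ptopologicalType)
    (d : measure_display) (Om : nat -> measurableType d)
    (P : forall n, probability (Om n) R) (X : forall n, {RV (P n) >-> borel T})
    (d' : measure_display) (Om' : measurableType d') (Q : probability Om' R)
    (Y : {RV Q >-> borel T}) : Prop :=
  forall f : T -> R, continuous f -> (exists M, forall x, `|f x| <= M) ->
    (fun n => expectation (P n) (fun w => f (X n w))) @ \oo -->
      expectation Q (fun w => f (Y w)).

(* The support of a random variable with values in a discrete finite space. *)
Definition discrete_support (R : realType) (T : ptopologicalType)
    (d : measure_display) (Om : measurableType d) (Q : probability Om R)
    (Y : {RV Q >-> borel T}) : set T :=
  [set x | (0 < distribution Q Y [set x])%E].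

Section snd_rv.
Context (R : realType) (T U : ptopologicalType) (d : measure_display)
  (Om : measurableType d) (Q : probability Om R).
Variable X : {RV Q >-> borel (T * U)%type}.

Definition snd_rv_fun (w : Om) : borel U := (X w).2.

Let measurable_snd_rv : measurable_fun [set: Om] snd_rv_fun.
Proof.
apply: (measurableT_comp (f := (snd : borel (T * U)%type -> borel U))) => //.
by apply: continuous_borel => x; exact: cvg_snd.
Qed.

HB.instance Definition _ :=
  isMeasurableFun.Build _ _ _ _ snd_rv_fun measurable_snd_rv.

Definition snd_rv : {RV Q >-> borel U} := snd_rv_fun.

End snd_rv.

Definition edge (n : nat) := {e : {set 'I_n} | #|e| == 2%N}.

Definition current (n : nat) := {ffun edge n -> nat}.

Definition current0 (n : nat) : current n := [ffun=> 0%N].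

HB.instance Definition _ n := Countable.on (current n).
HB.instance Definition _ n := isPointed.Build (current n) (current0 n).
HB.instance Definition _ n := @isMeasurable.Build default_measure_display
  (current n) discrete_measurable discrete_measurable0
  discrete_measurableC discrete_measurableU.

Section currents.
Context (n : nat).
Implicit Types (m : current n) (x y : 'I_n).

Definition current_add m1 m2 : current n := [ffun e => (m1 e + m2 e)%N].

Definition sources m : {set 'I_n} :=
  [set x | odd (\sum_(e : edge n | x \in val e) m e)%N]%SET.

Definition open_edge m : rel 'I_n :=
  fun x y => [exists e : edge n, (val e == [set x; y]%SET) && (0 < m e)%N].

Definition connected_in m : rel 'I_n := connect (open_edge m).

Definition cluster m x : {set 'I_n} := [set y | connected_in m x y]%SET.

End currents.

Definition partition_space (I : finType) : Type :=
  discrete_topology {set {set I}}.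

HB.instance Definition _ (I : finType) :=
  DiscreteTopology.on (partition_space I).
HB.instance Definition _ (I : finType) :=
  isPointed.Build (partition_space I) finset.set0.

Definition even_partitions (I : finType) : set (partition_space I) :=
  [set pi : {set {set I}} |
    finset.partition pi [set: I]%SET /\ forall B, B \in pi -> ~~ odd #|B|].
Arguments even_partitions I : clear implicits.

(* The set [S] of marked vertices is the image of the injection [v], and
   partitions of [S] are written as partitions of the set [I] of labels. *)
Definition current_partition (I : finType) (n : nat) (v : I -> 'I_n)
    (m : current n) : partition_space I :=
  equivalence_partition (fun i j => connected_in m (v i) (v j)) [set: I]%SET.

Section current_law.
Context (R : realType) (n : nat).

Definition weight (d : R) (m : current n) : R :=
  \prod_(e : edge n) (d ^+ m e / (m e)`!%:R).

(* Weights are nonnegative as soon as [0 <= d], so that the [Num.max] is only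
   there to make this a measure for every [d : R]. *)
Definition current_measure (d : R) (S : {set 'I_n}) (A : set (current n)) :
    \bar R :=
  \esum_(m in A `&` [set m | sources m = S]) (Num.max (weight d m) 0)%:E.

Context (d : R) (S : {set 'I_n}).

Let term_ge0 (m : current n) : (0 <= (Num.max (weight d m) 0)%:E)%E.
Proof. by rewrite lee_fin le_max lexx orbT. Qed.

Let current_measure0 : current_measure d S set0 = 0%E.
Proof. by rewrite /current_measure set0I esum_set0. Qed.

Let current_measure_ge0 A : (0 <= current_measure d S A)%E.
Proof. by apply: esum_ge0 => m _; exact: term_ge0. Qed.

Let current_measure_sigma_additive : semi_sigma_additive (current_measure d S).
Proof.
move=> F mF tF mUF; rewrite /current_measure setI_bigcupl.
rewrite nneseries_sum_bigcup //; last first.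
  exact: trivIset_setIr.
by apply: is_cvg_nneseries => k _ _; exact: current_measure_ge0.
Qed.

HB.instance Definition _ := isMeasure.Build _ _ _ (current_measure d S)
  current_measure0 current_measure_ge0 current_measure_sigma_additive.

(* [mnormalize] divides by the total mass, which is the partition function
   [Z^S]; the Dirac mass is only the default value for a total mass equal to
   [0] or [+oo], which does not occur for [0 < d] and [#|S|] even. *)
Definition current_law : probability (current n) R :=
  mnormalize (current_measure d S) \d_(current0 n).

End current_law.

Section current_rv.
Context (n : nat) (T : ptopologicalType) (F : current n -> T).

Definition single_fun (m : current n) : borel T := F m.

Let measurable_single_fun : measurable_fun [set: current n] single_fun.
Proof. by []. Qed.

HB.instance Definition _ :=
  isMeasurableFun.Build _ _ _ _ single_fun measurable_single_fun.

Definition single_rv : {mfun current n >-> borel T} := single_fun.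

Definition double_fun (m : current n * current n) : borel T :=
  F (current_add m.1 m.2).

Let measurable_double_fun :
  measurable_fun [set: current n * current n] double_fun.
Proof.
move=> _ B _; rewrite setTI; apply: countable_measurable => [m|].
  have -> : [set m] = [set m.1] `*` [set m.2].
    by apply/seteqP; split=> [_ ->//|[a b] [/= -> ->]]; case: m.
  exact: measurableX.
exact: sub_countable (subset_card_le (@subsetT _ _)) (countableP _).
Qed.

HB.instance Definition _ :=
  isMeasurableFun.Build _ _ _ _ double_fun measurable_double_fun.

Definition double_rv : {mfun (current n * current n)%type >-> borel T} :=
  double_fun.

End current_rv.

(* Sequences are indexed by [l] with [n = 2k + l], so that the first [2k]
   vertices of ['I_n] exist and are the image of ['I_(2 * k)] by [lshift l];
   [n] going to infinity means [l] going to infinity. *)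
Section scaling.
Context (R : realType) (lambda : R) (k l : nat).
Local Notation n := (2 * k + l)%N.

Definition dens : R := n%:R^-1 * (1 - lambda / Num.sqrt n%:R).

Definition mark : 'I_(2 * k) -> 'I_n := lshift l.

Definition marked : {set 'I_n} := [set mark i | i : 'I_(2 * k)]%SET.

Definition single_law : probability (current n) R := current_law dens marked.

Definition double_law : probability (current n * current n)%type R :=
  (single_law \x current_law dens finset.set0)%E.

Definition partition_of (m : current n) : partition_space 'I_(2 * k) :=
  current_partition mark m.

Definition clusters_and_partition (m : current n) :
    ('rV[R]_(2 * k) * partition_space 'I_(2 * k))%type :=
  (\row_i (#|cluster m (mark i)|%:R / Num.sqrt n%:R), partition_of m).

End scaling.

(* Main.v *)
(* The convergence of the partitions is that of a marginal, and parity confines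
   them to the even ones; the point is that each even partition keeps a
   probability bounded below. Expanding the exponentials of the Curie-Weiss
   weight shows that the sum of the weights of the currents with source set S
   and support in a given edge set is the average of sigma_S exp (d H) over all
   spin configurations. Flipping one spin and tanh y <= y - y^3/60 for
   0 <= y <= 2 give a recursion for the even moments of the magnetization,
   whence E[M^(2j)] = O(n^(3j/2)); with Griffiths' inequality and
   exchangeability, Z^S <= C n^(-k/2) Z^0 for #|S| = 2k, and by Jensen's
   inequality removing O(sqrt n) vertices costs only a constant factor in Z^0.

   For the lower bound, fix an even partition pi. A backbone is a current with
   source set S, inducing pi, with O(sqrt n) vertices, all connected to S. Pairs
   of sources of the same block are added one at a time, joined by a path of
   about sqrt n fresh vertices and one vertex x, which belongs to the component
   of the block if there is one already. There are of order sqrt n lengths,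
   positions of x and choices of x, so that each pair contributes a factor of
   order n^(3/2) d^2, i.e. n^(-1/2), to the total weight of the backbones, which
   is thus of order n^(-k/2). A sourceless current off the backbone does not
   change the partition and the backbone is recovered from the sum, so the
   probability of pi is at least a constant; for the double current the second
   current is put off the backbone as well. *)

Require Import Defs.
From HB Require Import structures.
From mathcomp Require Import all_boot all_order all_fingroup all_algebra.
From mathcomp Require Import all_classical all_reals all_analysis.
From mathcomp Require Import zify ring lra.

Set Implicit Arguments.
Unset Strict Implicit.
Unset Printing Implicit Defensive.

Import Order.TTheory GRing.Theory Num.Theory.
Import numFieldNormedType.Exports.

Local Open Scope classical_set_scope.
Local Open Scope ring_scope.

(** * Currents and spin sums *)

Section spin_sums.
Context (R : realType) (n : nat).
Implicit Types (s : {ffun 'I_n -> bool}) (Es : {set edge n}) (k : 'I_n -> nat).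

Definition spin s (x : 'I_n) : R := (-1) ^+ s x.

Definition edge_spin s (e : edge n) : R := \prod_(x in val e) spin s x.

Definition degree (m : current n) (x : 'I_n) : nat :=
  (\sum_(e : edge n | x \in val e) m e)%N.

Lemma spin_sqr s x : spin s x ^+ 2 = 1.
Proof. by rewrite /spin -exprM mulnC exprM sqrrN expr1n expr1n. Qed.

(** The sum factorizes over vertices, and a vertex contributes 2 for an even exponent and 0 for an
    odd one. This orthogonality is what turns spin averages into parity constraints on currents. *)
Lemma sum_spin_prod k :
  \sum_s \prod_x spin s x ^+ k x =
  if [forall x, ~~ odd (k x)] then 2 ^+ n else 0 :> R.
Proof.
pose F (x : 'I_n) (b : bool) : R := ((-1) ^+ b) ^+ k x.
rewrite (eq_bigr (fun s => \prod_x F x (s x))) //.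
rewrite -(bigA_distr_bigA F).
have FE x : \sum_b F x b = if odd (k x) then 0 else 2.
  rewrite /F big_bool /= expr1 expr0 expr1n -signr_odd.
  by case: (odd (k x)); rewrite ?expr1 ?expr0; lra.
case: ifPn => [/forallP ke|].
  rewrite (eq_bigr (fun=> 2)) ?prodr_const ?card_ord// => x _.
  by rewrite FE (negbTE (ke x)).
rewrite negb_forall => /existsP[x]; rewrite negbK => kx.
by rewrite (bigD1 x) //= FE kx mul0r.
Qed.

Lemma prod_edge_spin s (m : current n) :
  \prod_e edge_spin s e ^+ m e = \prod_x spin s x ^+ degree m x.
Proof.
rewrite (eq_bigr (fun e : edge n => \prod_(x in val e) spin s x ^+ m e));
  last first.
  by move=> e _; rewrite /edge_spin prodrXl.
rewrite (exchange_big_dep xpredT) //=; apply: eq_bigr => x _.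
by rewrite prodrXr.
Qed.

Definition supported Es (m : current n) := [forall e, (e \notin Es) ==> (m e == 0)].

Definition trunc_current N (f : {ffun edge n -> 'I_N.+1}) : current n :=
  [ffun e => val (f e)].

(** For [k] the indicator of [S] this says that the source set is [S]. General exponents allow
    repeated vertices, which occur when a power of the magnetization is expanded. *)
Definition parity_match k (m : current n) := [forall x, ~~ odd (k x + degree m x)].

(** An unnormalized Ising correlation on the graph with edge set [Es], averaged over uniform spins.
    It is the closed form of the total weight of the currents carried by [Es] with parities
    prescribed by [k]; for all edges it is the partition function $Z^S$ when [k] indicates $S$. *)
Definition spin_sum (d : R) Es k : R :=
  (2 ^+ n)^-1 * \sum_s (\prod_x spin s x ^+ k x) *
    expR (d * \sum_(e in Es) edge_spin s e).

(** Each exponential is cut at order [N] and the product over edges is multiplied out: a choice of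
    one term per edge is a current with values at most [N], and the sum over spins keeps those with
    matching parities. Only finite sums occur, and the limit is taken afterwards. *)
Lemma trunc_spin_sum (d : R) Es k N :
  (2 ^+ n)^-1 * \sum_s (\prod_x spin s x ^+ k x) *
     \prod_(e in Es) series (exp_coeff (d * edge_spin s e)) N.+1 =
  \sum_(f : {ffun edge n -> 'I_N.+1} | supported Es (trunc_current f)
     && parity_match k (trunc_current f)) weight d (trunc_current f).
Proof.
transitivity ((2 ^+ n)^-1 * \sum_s (\prod_x spin s x ^+ k x) *
  \sum_(f : {ffun edge n -> 'I_N.+1} | supported Es (trunc_current f))
     weight d (trunc_current f) * \prod_x spin s x ^+ degree (trunc_current f) x).
  congr (_ * _); apply: eq_bigr => s _; congr (_ * _).
  rewrite (eq_bigr (fun e => \sum_(j < N.+1) (d * edge_spin s e) ^+ j / j`!%:R));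
    last by move=> e _; rewrite /series/= big_mkord.
  rewrite (big_distr_big ord0); apply: eq_big => [f|f].
    apply/pffun_onP/forallP => [[/fintype.subsetP h _] e|h].
      by apply/implyP => eE; rewrite ffunE; apply: contraNT eE => fe; exact: h.
    split=> //; apply/fintype.subsetP => e; rewrite inE => fe.
    by move: (h e); rewrite ffunE; apply: contraTT => -> /=.
  move=> /pffun_onP[/fintype.subsetP h _].
  rewrite -prod_edge_spin /weight -big_split/= [RHS](bigID (mem Es))/=.
  rewrite [X in _ * X]big1 ?mulr1; last first.
    move=> e eE; rewrite ffunE.
    have /eqP -> : (val (f e) == 0)%N.
      by apply: contraNT eE => fe; apply: h; rewrite inE.
    by rewrite !expr0 invr1 !mulr1.
  apply: eq_bigr => e _; rewrite ffunE exprMn; set a := _`!%:R.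
  by rewrite mulrAC.
rewrite (eq_bigr (fun s => \sum_(f : {ffun edge n -> 'I_N.+1} |
   supported Es (trunc_current f)) weight d (trunc_current f) *
    \prod_x spin s x ^+ (k x + degree (trunc_current f) x))); last first.
  move=> s _; rewrite big_distrr/=; apply: eq_bigr => f _.
  rewrite mulrCA; congr (_ * _); rewrite -big_split/=.
  by apply: eq_bigr => x _; rewrite exprD.
rewrite exchange_big/= big_distrr/= [RHS]big_mkcondr/=.
apply: eq_bigr => f _; rewrite -big_distrr/= sum_spin_prod -/(parity_match _ _).
case: ifP => _; last by rewrite !mulr0.
by rewrite mulrCA mulVf ?mulr1// expf_neq0// pnatr_eq0.
Qed.

Lemma cvg_trunc_spin_sum (d : R) Es k :
  (fun N => \sum_(f : {ffun edge n -> 'I_N.+1} | supported Es (trunc_current f)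
     && parity_match k (trunc_current f)) weight d (trunc_current f)) @ \oo
  --> spin_sum d Es k.
Proof.
rewrite -(funext (trunc_spin_sum d Es k)) /spin_sum.
apply: cvgM; first exact: cvg_cst.
apply: (cvg_big add_continuous) => s _; apply: cvgM; first exact: cvg_cst.
rewrite big_distrr/= expR_sum; apply: (cvg_big (@mul_continuous R)) => e _.
have := @is_cvg_series_exp_coeff R (d * edge_spin s e).
by rewrite -cvg_shiftS.
Qed.

End spin_sums.

Lemma ler_sum_sub (R : numDomainType) (T : eqType) (s t : seq T) (F : T -> R) :
  uniq s -> uniq t -> {subset s <= t} -> (forall x, 0 <= F x) ->
  \sum_(x <- s) F x <= \sum_(x <- t) F x.
Proof.
move=> us ut st F0.
have sE : perm_eq s [seq x <- t | x \in s].
  apply: uniq_perm; rewrite ?filter_uniq// => x; rewrite mem_filter.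
  by case xs : (x \in s) => //=; rewrite st.
by rewrite (perm_big _ sE) big_filter [leRHS](bigID (mem s))/= lerDl sumr_ge0.
Qed.

Section current_sums.
Context (R : realType) (n : nat) (d : R).
Hypothesis d0 : 0 <= d.
Implicit Types (Es : {set edge n}) (k : 'I_n -> nat) (m : current n).

Lemma weight_ge0 m : 0 <= weight d m.
Proof. by apply: prodr_ge0 => e _; rewrite divr_ge0 ?exprn_ge0. Qed.

Lemma max_weight m : Num.max (weight d m) 0 = weight d m.
Proof. by apply/max_l/weight_ge0. Qed.

Lemma trunc_current_inj N : injective (@trunc_current n N).
Proof.
move=> f g /ffunP fg; apply/ffunP => e; apply: val_inj.
by have := fg e; rewrite !ffunE.
Qed.

Definition box Es k N : seq (current n) :=
  [seq trunc_current f | f : {ffun edge n -> 'I_N.+1} <-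
    enum [pred f : {ffun edge n -> 'I_N.+1} | supported Es (trunc_current f)
     && parity_match k (trunc_current f)]].

Lemma box_uniq Es k N : uniq (box Es k N).
Proof. by rewrite map_inj_uniq ?enum_uniq//; exact: trunc_current_inj. Qed.

Lemma sum_box Es k N : \sum_(m <- box Es k N) weight d m =
  \sum_(f : {ffun edge n -> 'I_N.+1} | supported Es (trunc_current f)
     && parity_match k (trunc_current f)) weight d (trunc_current f).
Proof. by rewrite /box big_map big_enum. Qed.

Lemma mem_box Es k N m : (m \in box Es k N) =
  [&& supported Es m, parity_match k m & [forall e, m e <= N]%N].
Proof.
apply/idP/idP => [/mapP[f]|/and3P[sm pm /forallP mN]].
  rewrite mem_enum inE => /andP[sf pf] ->; rewrite sf pf /=.
  by apply/forallP => e; rewrite ffunE -ltnS ltn_ord.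
have tE : trunc_current ([ffun e => inord (m e)] : {ffun edge n -> 'I_N.+1}) = m.
  by apply/ffunP => e; rewrite !ffunE; apply: inordK; rewrite ltnS.
apply/mapP; exists [ffun e => inord (m e) : 'I_N.+1]; rewrite ?mem_enum ?inE ?tE ?sm//.
Qed.

(** A finite family of currents has bounded values, so it lies in all large boxes, whose total
    weights converge to the spin sum. *)
Lemma sum_le_spin_sum Es k (s : seq (current n)) :
  uniq s -> (forall m, m \in s -> supported Es m && parity_match k m) ->
  \sum_(m <- s) weight d m <= spin_sum d Es k.
Proof.
move=> us sP; pose N := (\max_(m <- s) \max_e m e)%N.
have cvgS := @cvg_trunc_spin_sum R n d Es k.
rewrite -(cvg_lim _ cvgS)//; apply: limr_ge; first by apply/cvg_ex; eexists; exact: cvgS.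
near=> M; rewrite -sum_box; apply: ler_sum_sub => //.
- exact: box_uniq.
- move=> m ms; rewrite mem_box andbA sP//=; apply/forallP => e.
  have NM : (N <= M)%N by near: M; exact: nbhs_infty_ge.
  apply: leq_trans NM; rewrite /N.
  apply: (@leq_trans (\max_e m e)); first exact: leq_bigmax.
  exact: (@leq_bigmax_seq _ s xpredT (fun m : current n => \max_e m e)%N).
- exact: weight_ge0.
Unshelve. all: by end_near. Qed.

Lemma spin_sum_ge0 Es k : 0 <= spin_sum d Es k.
Proof.
have := @sum_le_spin_sum Es k [::] isT; rewrite big_nil.
exact.
Qed.

Lemma esum_le_spin_sum Es k (A : set (current n)) :
  (forall m, A m -> supported Es m && parity_match k m) ->
  (\esum_(m in A) (Num.max (weight d m) 0)%:E <= (spin_sum d Es k)%:E)%E.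
Proof.
move=> AP; apply: ge_ereal_sup => _ [F [finF FA] <-].
rewrite fsbig_finite//= sumEFin lee_fin.
under eq_bigr do rewrite max_weight.
apply: sum_le_spin_sum; first exact: finmap.fset_uniq.
move=> m; rewrite in_fset_set// inE => Fm.
exact/AP/FA.
Qed.

End current_sums.

(** * Moments of the magnetization in the critical window *)

Section edges.
Context (n : nat).

Definition pair_edge (x y : 'I_n) (xy : x != y) : edge n :=
  exist _ [set x; y]%SET (introT eqP (etrans (cards2 x y) (congr1 (fun b : bool => b.+1) xy))).

Lemma edge_eq_pair (e : edge n) (x y : 'I_n) : x != y -> x \in val e ->
  y \in val e -> val e = [set x; y]%SET.
Proof.
move=> xy xe ye; apply/esym/eqP; rewrite eqEcard finset.subUset !finset.sub1set xe ye /=.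
by rewrite (eqP (valP e)) cards2 xy.
Qed.

Lemma sum_edges (V : zmodType) (F : {set 'I_n} -> V) :
  (\sum_(e : edge n) F (val e)) *+ 2 =
  \sum_(x : 'I_n) \sum_(y : 'I_n | y != x) F [set x; y]%SET.
Proof.
transitivity (\sum_(e : edge n) \sum_(x in val e) \sum_(y in val e :\ x) F (val e)).
  rewrite -sumrMnl; apply: eq_bigr => e _.
  under eq_bigr => x xe.
    have := cardsD1 x (val e); rewrite xe (eqP (valP e)) => ce.
    have {}ce : #|val e :\ x| = 1%N by lia.
    rewrite sumr_const ce mulr1n; over.
  by rewrite sumr_const (eqP (valP e)).
rewrite (exchange_big_dep xpredT) //=; apply: eq_bigr => x _.
rewrite (exchange_big_dep [pred y | y != x]) /=; last first.
  by move=> e y _; rewrite finset.in_setD1 => /andP[].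
apply: eq_bigr => y yx; rewrite eq_sym in yx.
rewrite (big_pred1 (pair_edge yx)) //= => e; rewrite finset.in_setD1 eq_sym yx /=.
apply/andP/eqP => [[xe ye]|->]; last by rewrite /= finset.set21 finset.set22.
exact/val_inj/edge_eq_pair.
Qed.

Lemma card_touching_edges (D : {set 'I_n}) :
  (#|[set e : edge n | ~~ [disjoint val e & D]]| <= #|D| * n)%N.
Proof.
pose T := [set e : edge n | ~~ [disjoint val e & D]]%SET.
rewrite -[X in (_ * X)%N]card_ord -cardsT -cardsX -/T.
rewrite -(card_imset _ val_inj).
apply: leq_trans (leq_imset_card (fun p : 'I_n * 'I_n => [set p.1; p.2]%SET) _).
apply/subset_leq_card/fintype.subsetP => _ /imsetP[e + ->].
rewrite inE => /pred0Pn[x /andP[/= xe xD]].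
have := cardsD1 x (val e); rewrite xe (eqP (valP e)) => -[/esym/eqP/cards1P[y ey]].
apply/imsetP; exists (x, y); first by rewrite inE /= xD inE.
by rewrite /= -ey finset.setD1K.
Qed.

End edges.

(** * Hyperbolic inequalities on [0, 2] *)

Section hyperbolic.
Context (R : realType).

(** From $e^y \ge 1+y$ and $e^{-y} \le 1/(1+y)$ the difference is at least $2y - y^2/(1+y)$, and
    $y/(1+y) \le 2/3$ on the interval. *)
Lemma expR_sub_expRN_ge (y : R) : 0 <= y <= 2 ->
  4 / 3 * y <= expR y - expR (- y).
Proof.
move=> /andP[y0 y2].
have e1 := expR_ge1Dx y.
have : expR (- y) <= (1 + y)^-1.
  by rewrite expRN lef_pV2 ?posrE ?expR_gt0//; lra.
have -> : (1 + y)^-1 = 1 - y + y ^+ 2 * (1 + y)^-1 by field; lra.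
suff : y ^+ 2 * (1 + y)^-1 <= 2 / 3 * y by lra.
rewrite ler_pdivrMr; nra.
Qed.

Lemma expR_half_le2 : expR (2^-1 : R) <= 2.
Proof.
rewrite -[2^-1 in leLHS]opprK expRN -[leRHS]invrK lef_pV2 ?posrE ?expR_gt0//.
by have := expR_ge1Dx (- 2^-1 : R); lra.
Qed.

Lemma expR_add_expRN_le (y : R) : 0 <= y <= 2 -> expR y + expR (- y) <= 17.
Proof.
move=> /andP[y0 y2].
have : expR y <= expR 2 by rewrite ler_expR.
(* $e^2$ is the fourth power of $e^{1/2} \le 2$, so the sum is at most $16 + 1$. *)
have -> : (2 : R) = 4%:R * 2^-1 by lra.
rewrite expRM_natl => h.
have h2 : expR (2^-1 : R) ^+ 4 <= 2 ^+ 4.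
  by rewrite lerXn2r ?nnegrE ?expR_ge0//; exact: expR_half_le2.
have : expR (- y) <= 1 by rewrite expR_le1; lra.
by move: h h2; rewrite -natrX; lra.
Qed.

(** This is $\tanh y \le y - y^3/60$ cleared of its denominator. The difference of the two sides
    vanishes at 0, and its derivative [F'] is nonnegative by the two crude bounds above. *)
Lemma sinh_le_cosh (y : R) : 0 <= y <= 2 ->
  expR y - expR (- y) <= (y - y ^+ 3 / 60) * (expR y + expR (- y)).
Proof.
move=> /andP[y0 y2].
pose F (t : R) : R := (t - t ^+ 3 / 60) * (expR t + expR (- t)) - (expR t - expR (- t)).
pose F' (t : R) : R := (t - t ^+ 3 / 60) * (expR t - expR (- t))
  - t ^+ 2 / 20 * (expR t + expR (- t)).
have dF (t : R) : is_derive t 1 F (F' t).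
  rewrite /F; apply: is_derive_eq.
  rewrite /F' /GRing.scale /=.
  by field.
suff : F 0 <= F y.
  by rewrite /F oppr0 expR0 => h; move: h; rewrite expr0n/=; lra.
have F'0 (t : R) : 0 <= t <= 2 -> 0 <= F' t.
  move=> t02; have h1 := expR_sub_expRN_ge t02; have h2 := expR_add_expRN_le t02.
  have /andP[t0 t2] := t02; rewrite /F'.
  set S := expR t - _ in h1 *; set C := expR t + _ in h2 *.
  have a0 : 0 <= t - t ^+ 3 / 60 by nra.
  have : (t - t ^+ 3 / 60) * (4 / 3 * t) <= (t - t ^+ 3 / 60) * S by rewrite ler_wpM2l.
  have : t ^+ 2 / 20 * C <= t ^+ 2 / 20 * 17.
    by rewrite ler_wpM2l// divr_ge0// sqr_ge0.
  (* After division by $t^2$ this reads $17/20 \le 4/3 - t^2/45$, which holds for $t \le 2$. *)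
  suff : t ^+ 2 / 20 * 17 <= (t - t ^+ 3 / 60) * (4 / 3 * t) by lra.
  have -> : (t - t ^+ 3 / 60) * (4 / 3 * t) = t ^+ 2 * (4 / 3 - t ^+ 2 / 45) by field.
  have -> : t ^+ 2 / 20 * 17 = t ^+ 2 * (17 / 20) by field.
  have : t ^+ 2 <= 4 by nra.
  by move=> ?; rewrite ler_wpM2l ?sqr_ge0//; lra.
have dvF (t : R) : derivable F t 1 by have [] := dF t.
apply: (@ger0_derive1_le_cc R F 0 2).
- by move=> t _; exact: dvF.
- move=> t; rewrite in_itv/= => /andP[t0 t2]; rewrite derive1E.
  have [_ ->] := dF t; apply: F'0; lra.
- apply: derivable_within_continuous => t _; exact: dvF.
- by rewrite in_itv/= lexx; lra.
- by rewrite in_itv/= y0.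
- by [].
Qed.

End hyperbolic.

(** * The Curie-Weiss weight under the flip of one spin *)

Section flip.
Context (R : realType) (n : nat).
Implicit Types (s : {ffun 'I_n -> bool}) (x : 'I_n).
Local Notation spin := (@spin R n).

Definition magnetization s : R := \sum_x spin s x.

Definition local_field s x : R := \sum_(y | y != x) spin s y.

Definition boltzmann (d : R) s : R := expR (d * \sum_e edge_spin R s e).

Lemma magnetizationE s x : magnetization s = spin s x + local_field s x.
Proof. by rewrite /magnetization (bigD1 x). Qed.

Lemma norm_spin s x : `|spin s x| = 1.
Proof. by rewrite /spin normrX normrN1 expr1n. Qed.

Lemma normr_local_field s x : `|local_field s x| <= n%:R.
Proof.
rewrite /local_field (le_trans (ler_norm_sum _ _ _))//.
rewrite (eq_bigr (fun=> 1)) => [|y _]; last exact: norm_spin.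
rewrite sumr_const ler_nat -[leqRHS](card_ord n); exact: max_card.
Qed.

Lemma normr_magnetization s : `|magnetization s| <= n%:R.
Proof.
rewrite /magnetization (le_trans (ler_norm_sum _ _ _))//.
rewrite (eq_bigr (fun=> 1)) => [|y _]; last exact: norm_spin.
by rewrite sumr_const card_ord.
Qed.

(** On the complete graph the energy is a function of the magnetization alone: the diagonal of the
    expanded square gives [n], and each edge appears twice off the diagonal. *)
Lemma magnetization_sqr s :
  magnetization s ^+ 2 = n%:R + 2 * \sum_e edge_spin R s e.
Proof.
have := sum_edges (fun A : {set 'I_n} => \prod_(x in A) spin s x).
rewrite mulr_natl => ->.
transitivity (\sum_x (1 + spin s x * local_field s x)).
  rewrite expr2 {1}/magnetization big_distrl/=; apply: eq_bigr => x _.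
  by rewrite (magnetizationE s x) mulrDr -expr2 spin_sqr.
rewrite big_split/= sumr_const card_ord; congr (_ + _).
apply: eq_bigr => x _; rewrite /local_field big_distrr/=.
apply: eq_bigr => y yx; rewrite big_setU1 ?big_set1//.
by rewrite finset.in_set1 eq_sym.
Qed.

Definition flip x s : {ffun 'I_n -> bool} := [ffun y => s y (+) (y == x)].

Lemma flipK x : involutive (flip x).
Proof. by move=> s; apply/ffunP => y; rewrite !ffunE -addbA addbb addbF. Qed.

Lemma spin_flip x s : spin (flip x s) x = - spin s x.
Proof. by rewrite /spin ffunE eqxx addbT signrN. Qed.

Lemma local_field_flip x s : local_field (flip x s) x = local_field s x.
Proof.
by apply: eq_bigr => y yx; rewrite /spin ffunE (negbTE yx) addbF.
Qed.

(** This isolates the spin at [x]: the first factor is invariant under the flip at [x], and the flip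
    inverts the second one. *)
Lemma boltzmann_local (d : R) s x : boltzmann d s =
  expR (d / 2 * (local_field s x ^+ 2 + 1 - n%:R)) *
  expR (d * spin s x * local_field s x).
Proof.
rewrite /boltzmann -expRD; congr expR.
have := magnetization_sqr s; rewrite (magnetizationE s x) sqrrD spin_sqr => h.
have -> : \sum_e edge_spin R s e =
  (1 + spin s x * local_field s x *+ 2 + local_field s x ^+ 2 - n%:R) / 2.
  by rewrite h; field.
by field.
Qed.

Lemma sum_flip_le0 (G : {ffun 'I_n -> bool} -> R) x :
  (forall s, G s + G (flip x s) <= 0) -> \sum_s G s <= 0.
Proof.
move=> h; suff : (\sum_s G s) *+ 2 <= 0 by rewrite pmulrn_lle0.
rewrite mulr2n [X in _ + X](reindex_inj (inv_inj (flipK x)))/= -big_split/=.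
exact: sumr_le0.
Qed.

(* The spin at [x] has conditional mean tanh (d * local_field s x). *)
Lemma sum_spin_local_field_le (d : R) (j : nat) x :
  0 <= d -> d * n%:R <= 2 ->
  \sum_s boltzmann d s * (spin s x * local_field s x ^+ (j.*2.+1)
    - (d * local_field s x ^+ (j.*2.+2)
       - d ^+ 3 / 60 * local_field s x ^+ (j.*2.+4))) <= 0.
Proof.
move=> d0 dn; apply: (@sum_flip_le0 _ x) => s.
rewrite !(boltzmann_local d _ x) local_field_flip spin_flip.
set h := local_field s x; set w := expR (d / 2 * _).
have w0 : 0 < w by exact: expR_gt0.
have hn : `|d * h| <= 2.
  rewrite normrM (ger0_norm d0) (le_trans _ dn)// ler_wpM2l//.
  exact: normr_local_field.
pose g (y : R) := (y - y ^+ 3 / 60) * (expR y + expR (- y)) - (expR y - expR (- y)).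
have g0 y : 0 <= y <= 2 -> 0 <= g y by move=> /sinh_le_cosh; rewrite /g subr_ge0.
have gN y : g (- y) = - g y by rewrite /g opprK; ring.
(* The sum over a configuration and its flip is [- w] times this product. As [g] is odd and
   nonnegative on [0, 2], it has the sign of its argument, hence of the odd power of [h]. *)
suff key : 0 <= h ^+ (j.*2.+1) * g (d * h).
  rewrite (_ : _ + _ = - (w * (h ^+ (j.*2.+1) * g (d * h)))).
    by rewrite oppr_le0 mulr_ge0// ltW.
  have : spin s x = 1 \/ spin s x = -1.
    by rewrite /spin; case: (s x); rewrite ?expr1 ?expr0; [right|left].
  rewrite /g !exprS; set H := h ^+ j.*2.
  by case=> ->; rewrite ?mulrN1 ?opprK ?mulr1 ?mulN1r ?mul1r ?mulNr; ring.
have [h0|h0] := leP 0 h.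
  rewrite mulr_ge0 ?exprn_ge0// g0// mulr_ge0//=.
  by rewrite (le_trans (ler_norm _)).
rewrite exprS -mulrA mulrCA mulr_ge0//.
  by rewrite -muln2 exprM sqr_ge0.
rewrite -mulrNN -gN -mulrN mulr_ge0 ?oppr_ge0 ?(ltW h0)//.
rewrite g0// mulr_ge0 ?oppr_ge0 ?(ltW h0)//=.
by rewrite mulrN (le_trans (ler_norm _))// normrN.
Qed.

End flip.

(** * Recursion for the moments of the magnetization *)

Section moments.
Context (R : realType) (n : nat) (d : R).
Implicit Types (s : {ffun 'I_n -> bool}) (x : 'I_n).
Local Notation M := (@magnetization R n).
Local Notation bz := (boltzmann d).

(** Adding 1 makes this dominate the magnetization and all local fields in absolute value, and makes
    its powers nondecreasing in the exponent, so that error terms can be absorbed into moments. *)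
Definition amag s : R := 1 + `|M s|.

Definition moment (p : nat) : R := \sum_s bz s * amag s ^+ p.

Lemma amag_ge1 s : 1 <= amag s.
Proof. by rewrite /amag lerDl. Qed.

Lemma amag_ge0 s : 0 <= amag s.
Proof. by rewrite (le_trans ler01)// amag_ge1. Qed.

Lemma boltzmann_gt0 s : 0 < bz s.
Proof. exact: expR_gt0. Qed.

Lemma moment_gt0 p : 0 < moment p.
Proof.
rewrite /moment (bigD1 [ffun=> false])//= ltr_pwDl//.
  by rewrite mulr_gt0 ?boltzmann_gt0// exprn_gt0// (lt_le_trans ltr01)// amag_ge1.
by apply: sumr_ge0 => s _; rewrite mulr_ge0 ?exprn_ge0 ?amag_ge0// ltW// boltzmann_gt0.
Qed.

Lemma moment0_le p : moment 0 <= moment p.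
Proof.
apply: ler_sum => s _; rewrite ler_wpM2l ?(ltW (boltzmann_gt0 s))//.
by rewrite expr0 exprn_ege1// amag_ge1.
Qed.

(** Cauchy-Schwarz, obtained from the nonnegativity of the variance of [amag ^+ 2]; [a] is its
    mean. *)
Lemma sqr_moment2_le : moment 2 ^+ 2 <= moment 4 * moment 0.
Proof.
have m0 := moment_gt0 0.
set a := moment 2 / moment 0.
have : 0 <= \sum_s bz s * (amag s ^+ 2 - a) ^+ 2.
  by apply: sumr_ge0 => s _; rewrite mulr_ge0 ?sqr_ge0// ltW// boltzmann_gt0.
rewrite (_ : \sum_s _ = moment 4 - 2 * a * moment 2 + a ^+ 2 * moment 0).
  rewrite (_ : _ + _ = (moment 4 * moment 0 - moment 2 ^+ 2) / moment 0).
    by rewrite pmulr_lge0 ?invr_gt0// subr_ge0.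
  by rewrite /a; field; rewrite gt_eqF.
rewrite /moment !big_distrr/= -sumrB -big_split/=.
by apply: eq_bigr => s _; ring.
Qed.

Lemma local_field_le_amag s x : `|local_field R s x| <= amag s.
Proof.
have -> : local_field R s x = M s - spin R s x.
  by rewrite (magnetizationE R s x); ring.
by rewrite (le_trans (ler_normB _ _))// norm_spin addrC.
Qed.

Lemma norm_magnetization_le_amag s : `|M s| <= amag s.
Proof. by rewrite /amag lerDr. Qed.

(** The local field differs from the magnetization by a single spin, and the difference of powers
    factors through it. *)
Lemma subrX_local_field s x p :
  `|local_field R s x ^+ p.+1 - M s ^+ p.+1| <= p.+1%:R * amag s ^+ p.
Proof.
rewrite subrXX normrM.
have -> : local_field R s x - M s = - spin R s x.
  by rewrite (magnetizationE R s x); ring.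
rewrite normrN norm_spin mul1r (le_trans (ler_norm_sum _ _ _))//.
rewrite (_ : _ * _ = \sum_(i < p.+1) amag s ^+ p); last first.
  by rewrite sumr_const card_ord mulr_natl.
apply: ler_sum => i _; rewrite normrM !normrX.
have -> : amag s ^+ p = amag s ^+ (p.+1.-1 - i) * amag s ^+ i.
  by rewrite -exprD subnK// -ltnS.
by rewrite ler_pM ?exprn_ge0// lerXn2r ?nnegrE ?amag_ge0// ?local_field_le_amag//
  norm_magnetization_le_amag.
Qed.

Lemma amag_le_local_field s x q :
  amag s ^+ q <= 2 ^+ q * (`|local_field R s x| ^+ q + 2 ^+ q).
Proof.
set h := `|local_field R s x|.
have ah : amag s <= h + 2.
  rewrite /amag (magnetizationE R s x) addrC.
  by rewrite (le_trans (lerD (ler_normD _ _) (lexx 1)))// norm_spin /h; lra.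
have h0 : 0 <= h by exact: normr_ge0.
have [h2|h2] := leP h 2.
  apply: (@le_trans _ _ ((2 * 2) ^+ q)).
    by rewrite lerXn2r ?nnegrE ?amag_ge0//; lra.
  by rewrite exprMn ler_wpM2l ?exprn_ge0// lerDr exprn_ge0.
apply: (@le_trans _ _ ((2 * h) ^+ q)).
  by rewrite lerXn2r ?nnegrE ?amag_ge0//; lra.
by rewrite exprMn ler_wpM2l ?exprn_ge0// lerDl exprn_ge0.
Qed.

Hypothesis (d0 : 0 < d) (dn2 : d * n%:R <= 2) (n_gt0 : (0 < n)%N).

Lemma amag_le s : amag s <= 2 * n%:R.
Proof.
rewrite /amag; have := normr_magnetization R s.
have : (1 : R) <= n%:R by rewrite ler1n.
lra.
Qed.

(* The left-hand side is the sum over [x] of the quantities bounded in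
   [sum_spin_local_field_le], expanded around the full magnetization. *)
Lemma sum_local_field_ge s j :
  \sum_x (spin R s x * local_field R s x ^+ (j.*2.+1)
    - (d * local_field R s x ^+ (j.*2.+2)
       - d ^+ 3 / 60 * local_field R s x ^+ (j.*2.+4))) >=
  (1 - d * n%:R) * M s ^+ j.*2.+2
  - n%:R * (j.*2.+1 + 4 * j.*2.+2)%:R * amag s ^+ j.*2
  + n%:R * (d ^+ 3 / 60 * (2 ^- j.*2.+4 * amag s ^+ j.*2.+4 - 2 ^+ j.*2.+4)).
Proof.
have A0 := amag_ge0 s.
pose a : R := amag s ^+ j.*2.
have a0 : 0 <= a by rewrite exprn_ge0.
(* In [r], the coefficient $2j+1$ is the cost of replacing the local field by the magnetization in
   the odd power, and $4(2j+2)$ that in the even power, where $d$ times [amag] is at most 4 and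
   absorbs one factor. *)
pose r : R := - (j.*2.+1 + 4 * j.*2.+2)%:R * a - d * M s ^+ j.*2.+2 +
  d ^+ 3 / 60 * (2 ^- j.*2.+4 * amag s ^+ j.*2.+4 - 2 ^+ j.*2.+4).
apply: (@le_trans _ _ (\sum_x (spin R s x * M s ^+ j.*2.+1 + r))).
  rewrite big_split/= -big_distrl/= -/(magnetization R s) -exprS.
  rewrite sumr_const card_ord -[X in _ <= _ + X]mulr_natl /r -/a.
  move: (d ^+ 3 / 60 * _) (M s ^+ _) (_%:R : R) => u v w.
  by rewrite le_eqVlt; apply/orP; left; apply/eqP; ring.
apply: ler_sum => x _; set h := local_field R s x.
have h1 : spin R s x * M s ^+ j.*2.+1 - (j.*2.+1)%:R * a <= spin R s x * h ^+ j.*2.+1.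
  have := subrX_local_field s x j.*2; rewrite -/h -/a => H.
  have : `|spin R s x * (M s ^+ j.*2.+1 - h ^+ j.*2.+1)| <= (j.*2.+1)%:R * a.
    by rewrite normrM norm_spin mul1r distrC.
  by move=> /(le_trans (ler_norm _)); rewrite mulrBr; lra.
have h2 : d * h ^+ j.*2.+2 <= d * M s ^+ j.*2.+2 + (4 * j.*2.+2)%:R * a.
  have := subrX_local_field s x j.*2.+1; rewrite -/h => /(le_trans (ler_norm _)) H.
  have : d * (h ^+ j.*2.+2 - M s ^+ j.*2.+2) <= d * (j.*2.+2%:R * amag s ^+ j.*2.+1).
    by rewrite ler_wpM2l// ltW.
  suff : d * (j.*2.+2%:R * amag s ^+ j.*2.+1) <= (4 * j.*2.+2)%:R * a.
    by rewrite mulrBr; lra.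
  rewrite exprS -/a natrM.
  have : d * amag s <= 4.
    rewrite (le_trans (ler_wpM2l (ltW d0) (amag_le s)))// mulrCA.
    by rewrite (le_trans (ler_wpM2l (ler0n R 2) dn2))// -natrM.
  move=> /(ler_wpM2r (mulr_ge0 (ler0n R j.*2.+2) a0)).
  rewrite -subr_ge0 => /le_trans H4; rewrite -subr_ge0; apply: H4.
  move: (j.*2.+2)%:R => u.
  by rewrite le_eqVlt; apply/orP; left; apply/eqP; ring.
have h3 : d ^+ 3 / 60 * (2 ^- j.*2.+4 * amag s ^+ j.*2.+4 - 2 ^+ j.*2.+4)
    <= d ^+ 3 / 60 * h ^+ j.*2.+4.
  rewrite ler_wpM2l ?divr_ge0 ?exprn_ge0 ?(ltW d0)//.
  rewrite lerBlDr mulrC ler_pdivrMr ?exprn_gt0// mulrC.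
  rewrite (le_trans (amag_le_local_field s x _))// -/h -normrX ger0_norm//.
  by rewrite -[(j.*2.+4)%N]/((j.+2).*2)%N -muln2 exprM sqr_ge0.
rewrite /r natrD; lra.
Qed.

(** The cubic correction to the hyperbolic tangent, which bears the factor $nd^3$, controls the
    moment of order $2j+4$ by lower ones; near criticality the linear term almost cancels and leaves
    only [1 - d * n]. *)
Lemma sum_moment_le j :
  n%:R * (d ^+ 3 / 60) * 2 ^- j.*2.+4 * moment j.*2.+4 <=
  `|1 - d * n%:R| * moment j.*2.+2
  + n%:R * (j.*2.+1 + 4 * j.*2.+2)%:R * moment j.*2
  + n%:R * (d ^+ 3 / 60) * 2 ^+ j.*2.+4 * moment 0.
Proof.
have : \sum_(x : 'I_n) \sum_(s : {ffun 'I_n -> bool}) bz s * (spin R s x * local_field R s x ^+ (j.*2.+1)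
    - (d * local_field R s x ^+ (j.*2.+2)
       - d ^+ 3 / 60 * local_field R s x ^+ (j.*2.+4))) <= 0.
  apply: sumr_le0 => x _; apply: sum_spin_local_field_le => //; exact: ltW.
rewrite exchange_big/=; under eq_bigr do rewrite -big_distrr/=.
move=> H; rewrite -subr_le0; apply: le_trans H.
rewrite /moment !big_distrr/= -!big_split/= -sumrB.
apply: ler_sum => s _.
apply: le_trans (ler_wpM2l (ltW (boltzmann_gt0 s)) (sum_local_field_ge s j)).
rewrite -subr_ge0.
(* The sign of [1 - d * n] is arbitrary, so its term is bounded in absolute value. *)
have : 0 <= bz s * (`|1 - d * n%:R| * amag s ^+ j.*2.+2 + (1 - d * n%:R) * M s ^+ j.*2.+2).
  rewrite mulr_ge0 ?(ltW (boltzmann_gt0 s))//.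
  rewrite -lerBlDr sub0r (le_trans (ler_norm _))// normrN normrM ler_wpM2l//.
  by rewrite normrX lerXn2r ?nnegrE ?amag_ge0// norm_magnetization_le_amag.
move/le_trans; apply; move: (d ^+ 3 / 60) => w.
move: (amag s ^+ j.*2.+2) (M s ^+ j.*2.+2) (2 ^+ j.*2.+4).
move: (amag s ^+ j.*2.+4) (amag s ^+ j.*2) (bz s).
set nn : R := `|1 - d * n%:R|; move: nn.
move: (j.*2.+1 + 4 * j.*2.+2)%:R => q nn a4 a0 b a2 m2 t.
rewrite expr0; by rewrite le_eqVlt; apply/orP; left; apply/eqP; ring.
Qed.

End moments.

(** * Moment bounds uniform in the critical window *)

Section critical_moments.
Context (R : realType).

(** The integer [m] stands for $\sqrt n$ up to a factor 2, so that powers of $\sqrt n$ and path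
    lengths are written with a natural number. All later estimates are uniform over this window. *)
Definition critical_window (L : R) (n m : nat) (d : R) : Prop :=
  [/\ (0 < m)%N, (m ^ 2 <= n)%N, (n <= 4 * m ^ 2)%N,
      `|1 - d * n%:R| <= L / m%:R & 2^-1 <= d * n%:R <= 2].

Section window.
Context (L : R) (n m : nat) (d : R).
Hypothesis W : critical_window L n m d.

Lemma window_m_gt0 : (0 < m)%N. Proof. by case: W. Qed.

Lemma window_n_gt0 : (0 < n)%N.
Proof. by case: W => m0 mn _ _ _; apply: leq_trans mn; rewrite expn_gt0 m0. Qed.

Lemma window_mR_ge1 : 1 <= m%:R :> R.
Proof. by rewrite ler1n window_m_gt0. Qed.

Lemma window_nR_gt0 : 0 < n%:R :> R.
Proof. by rewrite ltr0n window_n_gt0. Qed.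

Lemma window_nR : m%:R ^+ 2 <= n%:R :> R /\ n%:R <= 4 * m%:R ^+ 2 :> R.
Proof. by case: W => _ h1 h2 _ _; rewrite -natrX -natrM !ler_nat. Qed.

Lemma window_d_gt0 : 0 < d.
Proof.
case: W => _ _ _ _ /andP[h _].
by rewrite -(pmulr_lgt0 _ window_nR_gt0) (lt_le_trans _ h).
Qed.

Lemma window_d_le : d * n%:R <= 2. Proof. by case: W => _ _ _ _ /andP[]. Qed.
End window.

(** In the window $nd^3$ is at least of order $m^{-4}$, while the coefficients on the other side are
    $O(m^{-1})$ and $O(m^2)$; division gives $m^3$ and $m^6$. The moment of order 0 is absorbed by
    that of order $2j$. *)
Lemma moment_rec (L : R) (j : nat) : 0 <= L ->
  exists2 K, 0 <= K & forall n m d, critical_window L n m d ->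
    moment n d j.*2.+4 <= K * (m%:R ^+ 3 * moment n d j.*2.+2 + m%:R ^+ 6 * moment n d j.*2).
Proof.
(* The value 480 comes from $dn \ge 1/2$: $n d^3/60 \ge (1/2)^3/(60 n^2)$. It is kept opaque for the
   arithmetic below. *)
move=> L0; have [w [w0 wE]] : exists w : R, 0 < w /\ w = 8 * 60.
  by exists (8 * 60); split=> //; lra.
have w0' := ltW w0; pose K' : R := (j.*2.+1 + 4 * j.*2.+2)%:R.
pose t : R := 2 ^+ j.*2.+4.
have t0 : 0 < t by rewrite exprn_gt0.
have K'0 : 0 <= K' by rewrite ler0n.
exists (w * t * (16 * L + 64 * (K' + t))).
  have ? := ltW t0.
  apply: mulr_ge0; first by apply: mulr_ge0; exact: ltW.
  apply: addr_ge0; first exact: mulr_ge0.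
  by apply: mulr_ge0 => //; exact: addr_ge0.
move=> n m d W; have := sum_moment_le (window_d_gt0 W) (window_d_le W) (window_n_gt0 W) j.
have m1 := window_mR_ge1 W; have n0 := window_nR_gt0 W.
have [nm1 nm2] := window_nR W; have d0 := window_d_gt0 W.
have m00 : moment n d 0 <= moment n d j.*2 by exact: moment0_le.
have a00 := @moment_gt0 R n d 0; have a0 := @moment_gt0 R n d j.*2.
have a2 := @moment_gt0 R n d j.*2.+2; have a4 := @moment_gt0 R n d j.*2.+4.
case: W => _ _ _ eps /andP[dn1 dn2].
rewrite -/K' -/t; clearbody t K'; move: m00 a00 a0 a2 a4.
move: (moment n d j.*2.+4) (moment n d j.*2.+2) (moment n d j.*2) (moment n d 0).
set e := `|_| in eps *; have e0 : 0 <= e by exact: normr_ge0.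
move: e e0 eps => e e0 eps A4 A2 A0 A00 A00A0 A00_gt0 A0_gt0 A2_gt0 A4_gt0 main.
have ndE : n%:R * (d ^+ 3 / 60) = (d * n%:R) ^+ 3 / (60 * n%:R ^+ 2).
  by field; rewrite gt_eqF.
rewrite ndE in main.
have lo : (w * n%:R ^+ 2)^-1 <= (d * n%:R) ^+ 3 / (60 * n%:R ^+ 2).
  rewrite (_ : _^-1 = 2^-1 ^+ 3 / (60 * n%:R ^+ 2)); last by rewrite wE; field; rewrite gt_eqF.
  rewrite ler_wpM2r ?invr_ge0 ?mulr_ge0 ?sqr_ge0//.
  by rewrite lerXn2r ?nnegrE// (le_trans _ dn1).
have hi : (d * n%:R) ^+ 3 / (60 * n%:R ^+ 2) <= n%:R.
  rewrite ler_pdivrMr ?mulr_gt0 ?exprn_gt0//.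
  apply: (@le_trans _ _ (2 ^+ 3)).
    by rewrite lerXn2r ?nnegrE ?mulr_ge0// ltW.
  have : 1 <= n%:R :> R by rewrite (le_trans _ nm1)// exprn_ege1.
  move=> n1; have : 1 <= n%:R ^+ 3 :> R by rewrite exprn_ege1.
  by rewrite (_ : _ * _ = 60 * n%:R ^+ 3); [lra|ring].
have {main} : (w * n%:R ^+ 2)^-1 / t * A4 <= L / m%:R * A2 + n%:R * K' * A0 + n%:R * t * A0.
  apply: (@le_trans _ _ ((d * n%:R) ^+ 3 / (60 * n%:R ^+ 2) / t * A4)).
    by rewrite ler_pM2r// ler_pM2r// invr_gt0.
  apply: (le_trans main); apply: lerD; first apply: lerD.
  - by rewrite ler_wpM2r// ltW.
  - by [].
  - have tt := ltW t0; apply: ler_pM => //; first 2 last.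
    + by rewrite ler_wpM2r.
    + by rewrite mulr_ge0// (le_trans _ lo)// invr_ge0 mulr_ge0// sqr_ge0.
    + exact: ltW.
have -> : (w * n%:R ^+ 2)^-1 / t * A4 = A4 / (w * n%:R ^+ 2 * t).
  by field; rewrite !gt_eqF.
rewrite ler_pdivrMr ?mulr_gt0 ?exprn_gt0// => main; apply: le_trans main _.
rewrite [leLHS](_ : _ = w * t * (L * (n%:R ^+ 2 / m%:R) * A2 + (K' + t) * n%:R ^+ 3 * A0)); last first.
  by field; rewrite gt_eqF// (lt_le_trans ltr01).
rewrite -[leRHS]mulrA ler_pM2l ?mulr_gt0//.
have mR0 : 0 < m%:R :> R by rewrite (lt_le_trans ltr01).
have n2 : n%:R ^+ 2 / m%:R <= 16 * m%:R ^+ 3 :> R.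
  rewrite ler_pdivrMr// (@le_trans _ _ ((4 * m%:R ^+ 2) ^+ 2))//.
    by rewrite lerXn2r ?nnegrE ?mulr_ge0 ?sqr_ge0// ltW.
  by rewrite le_eqVlt; apply/orP; left; apply/eqP; ring.
have n3 : n%:R ^+ 3 <= 64 * m%:R ^+ 6 :> R.
  rewrite (@le_trans _ _ ((4 * m%:R ^+ 2) ^+ 3))//.
    by rewrite lerXn2r ?nnegrE ?mulr_ge0 ?sqr_ge0// ltW.
  by rewrite le_eqVlt; apply/orP; left; apply/eqP; ring.
have Kt : 0 <= K' + t by rewrite addr_ge0// ltW.
apply: (@le_trans _ _ (L * (16 * m%:R ^+ 3) * A2 + (K' + t) * (64 * m%:R ^+ 6) * A0)).
  apply: lerD; rewrite ler_pM2r//; exact: ler_wpM2l.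
rewrite -subr_ge0 (_ : _ - _ = 16 * L * (m%:R ^+ 6 * A0) +
  64 * (K' + t) * (m%:R ^+ 3 * A2)); last by ring.
have [m6 m3] : 0 <= m%:R ^+ 6 * A0 /\ 0 <= m%:R ^+ 3 * A2.
  by rewrite !mulr_ge0 ?exprn_ge0 ?(ltW A0_gt0) ?(ltW A2_gt0).
by apply: addr_ge0; apply: mulr_ge0 => //; exact: mulr_ge0.
Qed.

Lemma quadratic_bound (K v a : R) : 0 <= K -> 0 < v ->
  a ^+ 2 <= K * v * a + K * v ^+ 2 -> a <= (K + 1) * v.
Proof.
move=> K0 v0 q; rewrite leNgt; apply/negP => c.
have Kv : 0 < (K + 1) * v by rewrite mulr_gt0// ltr_wpDl.
have a0 := lt_trans Kv c.
have h1 : (K + 1) * v * a < a * a by rewrite ltr_pM2r.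
have h2 : v * ((K + 1) * v) < v * a by rewrite ltr_pM2l.
have v2 : 0 < v * v by rewrite mulr_gt0.
move: q; rewrite !expr2; lra.
Qed.

(** With the exponent $3j$ both terms of the recursion have the same order $m^{3(j+2)}$. The
    recursion has two steps, so two consecutive bounds are carried through the induction. *)
Lemma moment_bound (L : R) (j : nat) : 0 <= L ->
  exists2 B, 0 <= B & forall n m d, critical_window L n m d ->
    moment n d j.*2 <= B * m%:R ^+ (3 * j) * moment n d 0.
Proof.
move=> L0.
suff : (exists2 B, 0 <= B & forall n m d, critical_window L n m d ->
    moment n d j.*2 <= B * m%:R ^+ (3 * j) * moment n d 0) /\
   (exists2 B, 0 <= B & forall n m d, critical_window L n m d ->
    moment n d j.+1.*2 <= B * m%:R ^+ (3 * j.+1) * moment n d 0) by case.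
elim: j => [|j [[B0 B00 h0] [B1 B10 h1]]].
  split; first by exists 1 => // n m d W; rewrite muln0 expr0 !mul1r.
  (* The recursion bounds the fourth moment by the second; with Cauchy-Schwarz this closes into a
     quadratic inequality for the second moment. *)
  have [K K0 h] := moment_rec 0 L0.
  exists (K + 1); first by rewrite addr_ge0.
  move=> n m d W; have m1 := window_mR_ge1 W.
  have mR0 : 0 < m%:R :> R by rewrite (lt_le_trans ltr01).
  have a0 := @moment_gt0 R n d 0; have a2 := @moment_gt0 R n d 2.
  have := h _ _ _ W; have := @sqr_moment2_le R n d.
  rewrite /= -![0.*2.+4]/4%N -![0.*2.+2]/2%N -![0.*2]/0%N -![1.*2]/2%N muln1.
  move: (moment n d 0) (moment n d 2) (moment n d 4) a0 a2 => A0 A2 A4 A0_gt0 A2_gt0 s4 r4.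
  have {s4 r4} : A2 ^+ 2 <= K * (m%:R ^+ 3 * A2 + m%:R ^+ 6 * A0) * A0.
    by rewrite (le_trans s4)// ler_pM2r.
  rewrite (_ : m%:R ^+ 6 = (m%:R ^+ 3) ^+ 2); last by ring.
  have : 0 < m%:R ^+ 3 :> R by rewrite exprn_gt0.
  move: (m%:R ^+ 3) => u u0 q.
  rewrite -mulrA; apply: quadratic_bound; rewrite ?mulr_gt0//.
  by rewrite (le_trans q)// le_eqVlt; apply/orP; left; apply/eqP; ring.
split; first by exists B1.
have [K K0 h] := moment_rec j L0.
exists (K * (B1 + B0)); first by rewrite mulr_ge0 ?addr_ge0.
move=> n m d W; apply: (le_trans (h _ _ _ W)).
have mR0 : 0 <= m%:R :> R by rewrite ler0n.
rewrite -mulrA -[leRHS]mulrA ler_wpM2l//.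
rewrite mulrDl lerD//.
  rewrite (le_trans (ler_wpM2l _ (h1 _ _ _ W))) ?exprn_ge0//.
  have -> : m%:R ^+ (3 * j.+2) = m%:R ^+ 3 * m%:R ^+ (3 * j.+1) :> R.
    by rewrite -exprD; congr (_ ^+ _); lia.
  move: (m%:R ^+ (3 * j.+1)) (m%:R ^+ 3) (moment n d 0) => p q r.
  by rewrite le_eqVlt; apply/orP; left; apply/eqP; ring.
rewrite (le_trans (ler_wpM2l _ (h0 _ _ _ W))) ?exprn_ge0//.
have -> : m%:R ^+ (3 * j.+2) = m%:R ^+ 6 * m%:R ^+ (3 * j) :> R.
  by rewrite -exprD; congr (_ ^+ _); lia.
move: (m%:R ^+ (3 * j)) (m%:R ^+ 6) (moment n d 0) => p q r.
by rewrite le_eqVlt; apply/orP; left; apply/eqP; ring.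
Qed.

End critical_moments.

(** * Spin correlations and removal of vertices *)

Section correlations.
Context (R : realType) (n : nat) (d : R).
Local Notation spin := (@spin R n).
Local Notation config := {ffun 'I_n -> bool}.
Local Notation edges := [set: edge n]%SET.
Implicit Types (s : {ffun 'I_n -> bool}) (S : {set 'I_n}) (D : {set 'I_n}).

Definition in_exp S : 'I_n -> nat := fun x => (x \in S) : nat.

(** Each set is listed first and its complement after it; the permutation matches equal positions in
    the two lists. *)
Lemma exists_perm_imset S S' : #|S| = #|S'| ->
  exists p : {perm 'I_n}, [set p x | x in S]%SET = S'.
Proof.
move=> SS'.
pose l (A : {set 'I_n}) := enum A ++ enum (~: A)%SET.
have lu (A : {set 'I_n}) : uniq (l A).
  rewrite cat_uniq !enum_uniq andbT /=; apply/hasPn => x.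
  by rewrite !mem_enum finset.in_setC.
have lT (A : {set 'I_n}) x : x \in l A.
  by rewrite mem_cat !mem_enum finset.in_setC orbN.
have ls (A : {set 'I_n}) : size (l A) = n.
  by rewrite size_cat -!cardE cardsC card_ord.
pose f x := nth x (l S') (index x (l S)).
have f_inj : injective f.
  move=> x y; have ix : (index x (l S) < n)%N by have := index_mem x (l S); rewrite lT ls.
  have iy : (index y (l S) < n)%N by have := index_mem y (l S); rewrite lT ls.
  rewrite /f (set_nth_default y) ?ls// => /eqP.
  rewrite nth_uniq ?ls// => /eqP /(congr1 (nth x (l S))).
  by rewrite !nth_index.
exists (perm f_inj); apply/eqP; rewrite eqEcard card_imset ?SS' ?leqnn ?andbT; last exact: perm_inj.
apply/fintype.subsetP => _ /imsetP[x xS ->]; rewrite permE /f.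
have ix : (index x (l S) < #|S'|)%N.
  by rewrite /l index_cat mem_enum xS -SS' cardE index_mem mem_enum.
by rewrite nth_cat -cardE ix -mem_enum mem_nth// -cardE.
Qed.

Lemma spin_sumE Es (k : 'I_n -> nat) : Es = edges ->
  spin_sum d Es k = (2 ^+ n)^-1 * \sum_(s : config) boltzmann d s * \prod_x spin s x ^+ k x.
Proof.
move=> ->; rewrite /spin_sum; congr (_ * _); apply: eq_bigr => s _.
rewrite mulrC /boltzmann; congr (expR (d * _) * _).
by apply: eq_bigl => e; rewrite inE.
Qed.

Definition spin_prod S s : R := \prod_(x in S) spin s x.

Lemma prod_in_exp S s : \prod_x spin s x ^+ in_exp S x = spin_prod S s.
Proof.
rewrite /spin_prod [RHS]big_mkcond/=; apply: eq_bigr => x _.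
by rewrite /in_exp; case: (x \in S); rewrite ?expr1 ?expr0.
Qed.

Lemma boltzmann_magnetization s s' : magnetization R s = magnetization R s' ->
  boltzmann d s = boltzmann d s'.
Proof.
move=> ss'; rewrite /boltzmann; congr (expR (d * _)).
have := magnetization_sqr R s; rewrite ss' magnetization_sqr.
by move/addrI/(mulfI (_ : 2 != 0 :> R)) => <-.
Qed.

(** Exchangeability: permuting the vertices preserves the magnetization, hence the Boltzmann
    weight. *)
Lemma sum_spin_prod_perm S S' : #|S| = #|S'| ->
  \sum_(s : config) boltzmann d s * spin_prod S s = \sum_(s : config) boltzmann d s * spin_prod S' s.
Proof.
move=> /exists_perm_imset[p pS].
pose h s : {ffun 'I_n -> bool} := [ffun x => s (p x)].
have h_inj : injective h.
  move=> s s' /ffunP ss'; apply/ffunP => x.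
  by have := ss' ((p^-1)%g x); rewrite !ffunE permKV.
rewrite (reindex_inj h_inj)/=; apply: eq_bigr => s _; congr (_ * _).
  apply: boltzmann_magnetization; rewrite /magnetization.
  rewrite [RHS](reindex_inj (@perm_inj _ p))/=.
  by apply: eq_bigr => x _; rewrite /spin ffunE.
rewrite /spin_prod -pS big_imset/=; last by move=> x y _ _; exact: perm_inj.
by apply: eq_bigr => x _; rewrite /spin ffunE.
Qed.

Hypothesis d0 : 0 <= d.

(* Griffiths' first inequality *)
Lemma sum_spin_prod_ge0 (k : 'I_n -> nat) :
  0 <= \sum_(s : config) boltzmann d s * \prod_x spin s x ^+ k x.
Proof.
have := spin_sum_ge0 d0 edges k; rewrite spin_sumE//.
by rewrite pmulr_rge0 ?invr_gt0 ?exprn_gt0.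
Qed.

(** The power of the magnetization expands over all maps from [r] places to the vertices. Each
    injective map contributes the correlation of [S] by exchangeability, and the other maps
    contribute nonnegatively by Griffiths' inequality. *)
Lemma sum_spin_prod_le_moment S :
  (n ^_ #|S|)%:R * (\sum_(s : config) boltzmann d s * spin_prod S s) <= moment n d #|S|.
Proof.
pose r := #|S|.
have -> : moment n d r = \sum_(s : config) boltzmann d s * amag R s ^+ r by [].
apply: (@le_trans _ _ (\sum_(s : config) boltzmann d s * magnetization R s ^+ r)); last first.
  apply: ler_sum => s _; rewrite ler_wpM2l ?expR_ge0//.
  rewrite (le_trans (ler_norm _))// normrX lerXn2r ?nnegrE ?amag_ge0//.
  exact: norm_magnetization_le_amag.
have -> : \sum_(s : config) boltzmann d s * magnetization R s ^+ r =
   \sum_(f : {ffun 'I_r -> 'I_n}) \sum_(s : config) boltzmann d s * \prod_i spin s (f i).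
  rewrite exchange_big/=; apply: eq_bigr => s _; rewrite -big_distrr/=; congr (_ * _).
  by rewrite -(bigA_distr_bigA (fun (i : 'I_r) x => spin s x))/= prodr_const card_ord.
rewrite (bigID (fun f : {ffun 'I_r -> 'I_n} => injectiveb f))/= -[leLHS]addr0 lerD//.
  rewrite [leRHS](eq_bigr (fun=> \sum_(s : config) boltzmann d s * spin_prod S s)); last first.
    move=> f hf; have f_inj : injective f by apply/injectiveP.
    rewrite [RHS](@sum_spin_prod_perm _ [set f i | i : 'I_r]%SET).
      apply: eq_bigr => s _; congr (_ * _).
      by rewrite /spin_prod big_imset/=; [exact: eq_bigl|move=> x y _ _; exact: f_inj].
    by rewrite card_imset// card_ord.
  have := card_inj_ffuns 'I_r 'I_n; rewrite cardsE !card_ord => cE.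
  by rewrite sumr_const mulr_natl -cE.
apply: sumr_ge0 => f _.
(* The fibre sizes of [f] are the exponents to which Griffiths' inequality is applied. *)
suff -> : \sum_(s : config) boltzmann d s * \prod_i spin s (f i) =
  \sum_(s : config) boltzmann d s * \prod_x spin s x ^+ #|[set i | f i == x]%SET|.
  exact: sum_spin_prod_ge0.
apply: eq_bigr => s _; congr (_ * _).
rewrite (partition_big f xpredT)//=; apply: eq_bigr => x _.
rewrite (eq_bigr (fun=> spin s x)); last by move=> i /eqP ->.
by rewrite prodr_const cardsE.
Qed.

(* Jensen's inequality for [expR] *)
Lemma spin_sum_off_ge (D : {set 'I_n}) (B : R) : 0 <= B ->
  (forall S, #|S| = 2 -> \sum_(s : config) boltzmann d s * spin_prod S s <=
    B * \sum_(s : config) boltzmann d s) ->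
  expR (- (d * (#|D| * n)%:R * B)) * spin_sum d edges (fun=> 0%N) <=
  spin_sum d [set e : edge n | [disjoint val e & D]]%SET (fun=> 0%N).
Proof.
move=> B0 hB; set off := [set e | _]%SET.
have prod1 s : \prod_x spin s x ^+ 0 = 1 by rewrite big1.
rewrite /spin_sum mulrCA ler_pM2l ?invr_gt0 ?exprn_gt0//.
pose Z := \sum_(s : config) boltzmann d s.
have Z0 : 0 < Z.
  by rewrite /Z (bigD1 [ffun=> false])//= ltr_pwDl ?expR_gt0// sumr_ge0// => s _; exact: expR_ge0.
(* [Y] is the energy of the removed edges, those that meet [D]; [mu] below is its mean. *)
pose Y s := d * \sum_(e in ~: off) edge_spin R s e.
have YE s : boltzmann d s * expR (- Y s) = expR (d * \sum_(e in off) edge_spin R s e).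
  rewrite /boltzmann -expRD; congr expR; rewrite /Y -mulrBr; congr (_ * _).
  rewrite (bigID (mem off))/= [X in _ + X - _](eq_bigl (mem (~: off))) ?addrK// => e.
  by rewrite [in RHS]inE/= finset.in_setC.
rewrite (eq_bigr (boltzmann d)); last first.
  move=> s _; rewrite prod1 mul1r /boltzmann; congr (expR (d * _)).
  by apply: eq_bigl => e; rewrite inE.
rewrite [leRHS](eq_bigr (fun s => boltzmann d s * expR (- Y s))); last first.
  by move=> s _; rewrite YE prod1 mul1r.
pose mu := (\sum_(s : config) boltzmann d s * Y s) / Z.
have muB : mu <= d * (#|D| * n)%:R * B.
  rewrite ler_pdivrMr// -!mulrA.
  rewrite (eq_bigr (fun s => d * (\sum_(e in ~: off) boltzmann d s * edge_spin R s e))); last first.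
    by move=> s _; rewrite /Y mulrCA big_distrr.
  rewrite -big_distrr/= ler_wpM2l// exchange_big/=.
  apply: (@le_trans _ _ (\sum_(e in ~: off) B * Z)).
    by apply: ler_sum => e _; apply: hB; rewrite (eqP (valP e)).
  rewrite sumr_const -[leLHS]mulr_natl; apply: ler_wpM2r.
    by rewrite mulr_ge0// ltW.
  rewrite ler_nat.
  apply: leq_trans (card_touching_edges D).
  by apply/subset_leq_card/fintype.subsetP => e; rewrite !inE.
apply: (@le_trans _ _ (expR (- mu) * Z)).
  by rewrite ler_pM2r// ler_expR lerN2.
(* The exponential is bounded below by its tangent at the mean, whose linear term has average
   zero. *)
apply: (@le_trans _ _ (\sum_(s : config) boltzmann d s * (expR (- mu) * (1 - (Y s - mu))))).
  rewrite (_ : \sum_(s : config) _ = expR (- mu) * (Z + mu * Z - \sum_(s : config) boltzmann d s * Y s)).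
    by rewrite /mu divfK ?gt_eqF// addrK.
  rewrite /Z !big_distrr/= -big_split/= -sumrB big_distrr/=.
  by apply: eq_bigr => s _; ring.
apply: ler_sum => s _; rewrite ler_wpM2l ?expR_ge0//.
have -> : - Y s = - mu + - (Y s - mu) by ring.
by rewrite expRD ler_wpM2l ?expR_ge0// expR_ge1Dx.
Qed.

End correlations.

(** * Bounds on partition functions uniform in the window *)

Section uniform_bounds.
Context (R : realType).
Local Notation edges n := [set: edge n]%SET.

Lemma expn_le_ffact (n r : nat) : (2 * r <= n)%N -> (n ^ r <= 2 ^ r * n ^_ r)%N.
Proof.
move=> rn; rewrite ffact_prod -{2}(card_ord r) -prod_nat_const -big_split/=.
rewrite -[X in (n ^ X)%N](card_ord r) -prod_nat_const.
by apply: leq_prod => i _; have := ltn_ord i; lia.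
Qed.

Lemma moment0E n d : moment n d 0 = \sum_(s : {ffun 'I_n -> bool}) boltzmann d s :> R.
Proof. by apply: eq_bigr => s _; rewrite expr0 mulr1. Qed.

(** The moment of order $2k$ is $O(m^{3k})$ relative to the partition function, and the falling
    factorial is at least of order $n^{2k} \ge m^{4k}$; the quotient leaves $m^{-k}$. *)
Lemma correlation_bound (L : R) k : 0 <= L ->
  exists2 C, 0 <= C & forall n m d (S : {set 'I_n}), critical_window L n m d ->
    (4 * k <= n)%N -> #|S| = k.*2 ->
    \sum_(s : {ffun 'I_n -> bool}) boltzmann d s * spin_prod R S s <=
    C / m%:R ^+ k * \sum_(s : {ffun 'I_n -> bool}) boltzmann d s.
Proof.
move=> L0; have [B B0 hB] := moment_bound k L0.
exists (2 ^+ k.*2 * B); first by rewrite mulr_ge0 ?exprn_ge0.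
move=> n m d S W kn Sk.
have m1 := window_mR_ge1 W; have m0 : 0 < m%:R :> R by rewrite (lt_le_trans ltr01).
have d0 := window_d_gt0 W.
have := sum_spin_prod_le_moment (ltW d0) S.
have := hB _ _ _ W; rewrite moment0E Sk.
have : 0 <= \sum_(s : {ffun 'I_n -> bool}) boltzmann d s * spin_prod R S s.
  have := sum_spin_prod_ge0 (ltW d0) (in_exp S).
  by under eq_bigr do rewrite prod_in_exp.
set T := \sum_s _; set Z := \sum_s _; move=> T0 hM hT.
have {hM}hT := le_trans hT hM.
have nm : m%:R ^+ (4 * k) <= 2 ^+ k.*2 * (n ^_ k.*2)%:R :> R.
  rewrite -!natrX -natrM ler_nat; apply: (@leq_trans (n ^ k.*2)).
    rewrite (_ : (4 * k = 2 * k.*2)%N) ?expnM; last by lia.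
    by case: k.*2 => // r; rewrite leq_exp2r//; case: W.
  by apply: expn_le_ffact; lia.
have : m%:R ^+ (4 * k) * T <= 2 ^+ k.*2 * B * m%:R ^+ (3 * k) * Z.
  apply: (le_trans (ler_wpM2r T0 nm)); rewrite -!mulrA ler_wpM2l ?exprn_ge0//.
  by rewrite (le_trans hT)// -!mulrA.
have -> : m%:R ^+ (4 * k) = m%:R ^+ (3 * k) * m%:R ^+ k :> R.
  by rewrite -exprD; congr (_ ^+ _); lia.
have a0 : 0 < m%:R ^+ (3 * k) :> R by rewrite exprn_gt0.
have b0 : 0 < m%:R ^+ k :> R by rewrite exprn_gt0.
move: (m%:R ^+ (3 * k)) (m%:R ^+ k) (2 ^+ k.*2) a0 b0 => a b t a0 b0.
rewrite (_ : t * B * a * Z = a * (t * B * Z)); last by ring.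
rewrite -mulrA ler_pM2l// => h.
rewrite (_ : t * B / b * Z = (t * B * Z) / b); last by ring.
by rewrite ler_pdivlMr// mulrC.
Qed.

Lemma spin_sum0E n d : spin_sum d (edges n) (fun=> 0%N) =
  (2 ^+ n)^-1 * \sum_(s : {ffun 'I_n -> bool}) boltzmann d s :> R.
Proof.
rewrite spin_sumE//; congr (_ * _); apply: eq_bigr => s _.
by rewrite big1 ?mulr1.
Qed.

Lemma spin_sum0_gt0 n (d : R) : 0 < spin_sum d (edges n) (fun=> 0%N).
Proof.
rewrite spin_sum0E mulr_gt0 ?invr_gt0 ?exprn_gt0//.
by rewrite -moment0E moment_gt0.
Qed.

Lemma spin_sum_sources_le (L : R) k : 0 <= L ->
  exists2 C, 0 < C & forall n m d (S : {set 'I_n}), critical_window L n m d ->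
    (4 * k <= n)%N -> #|S| = k.*2 ->
    spin_sum d (edges n) (in_exp S) <= C / m%:R ^+ k * spin_sum d (edges n) (fun=> 0%N).
Proof.
move=> L0; have [C C0 h] := correlation_bound k L0.
exists (C + 1); first by rewrite ltr_wpDl.
move=> n m d S W kn Sk.
rewrite spin_sum0E spin_sumE// mulrCA ler_pM2l ?invr_gt0 ?exprn_gt0//.
under eq_bigr do rewrite prod_in_exp.
apply: (le_trans (h _ _ _ _ W kn Sk)); rewrite ler_wpM2r//.
  by rewrite -moment0E ltW// moment_gt0.
by rewrite ler_wpM2r ?invr_ge0 ?exprn_ge0// lerDl.
Qed.

(** At most $Kmn$ edges are removed, each has coupling [d] and two-point correlation $O(1/m)$, and
    $dn \le 2$; the mean removed energy is therefore bounded. *)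
Lemma spin_sum_off_lower (L : R) K : 0 <= L ->
  exists2 c, 0 < c & forall n m d (D : {set 'I_n}), critical_window L n m d ->
    (4 <= n)%N -> (#|D| <= K * m)%N ->
    c * spin_sum d (edges n) (fun=> 0%N) <=
    spin_sum d [set e : edge n | [disjoint val e & D]]%SET (fun=> 0%N).
Proof.
move=> L0; have [C C0 h] := correlation_bound 1 L0.
exists (expR (- (2 * K%:R * C))); first exact: expR_gt0.
move=> n m d D W n4 Dm; have d0 := window_d_gt0 W.
have m1 := window_mR_ge1 W; have m0 : 0 < m%:R :> R by rewrite (lt_le_trans ltr01).
have Cm : 0 <= C / m%:R by rewrite divr_ge0.
have hS (S : {set 'I_n}) : #|S| = 2 ->
    \sum_(s : {ffun 'I_n -> bool}) boltzmann d s * spin_prod R S s <=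
    C / m%:R * \sum_(s : {ffun 'I_n -> bool}) boltzmann d s.
  by move=> S2; have := h n m d S W; rewrite muln1 expr1; exact.
apply: le_trans (spin_sum_off_ge (ltW d0) D Cm hS).
rewrite ler_pM2r ?spin_sum0_gt0// ler_expR lerN2 natrM.
have dn2 := window_d_le W.
have Dm' : #|D|%:R <= K%:R * m%:R :> R by rewrite -natrM ler_nat.
rewrite (_ : _ * _ = (d * n%:R) * (#|D|%:R / m%:R * C)); last by ring.
rewrite -[leRHS]mulrA; apply: ler_pM => //.
- by rewrite mulr_ge0// ltW.
- by rewrite mulr_ge0// divr_ge0.
- by rewrite ler_wpM2r// ler_pdivrMr.
Qed.

End uniform_bounds.

(** * Path currents *)

Section current_algebra.
Context (n : nat).
Implicit Types (m : current n) (x y z : 'I_n) (p : seq 'I_n).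
Local Notation add := (@current_add n).

Lemma current_addC : commutative add.
Proof. by move=> m1 m2; apply/ffunP => e; rewrite !ffunE addnC. Qed.

Lemma current_addA : associative add.
Proof. by move=> m1 m2 m3; apply/ffunP => e; rewrite !ffunE addnA. Qed.

Lemma current_add0 m : add (current0 n) m = m.
Proof. by apply/ffunP => e; rewrite !ffunE. Qed.

Lemma current_addr0 m : add m (current0 n) = m.
Proof. by rewrite current_addC current_add0. Qed.

Lemma current_addIr m : injective (add^~ m).
Proof.
by move=> m1 m2 /ffunP h; apply/ffunP => e; have := h e; rewrite !ffunE => /addIn.
Qed.

Definition support m : {set 'I_n} :=
  [set x | [exists e : edge n, (x \in val e) && (0 < m e)%N]]%SET.

Lemma in_supportP m x :
  reflect (exists2 e : edge n, x \in val e & (0 < m e)%N) (x \in support m).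
Proof.
rewrite inE; apply: (iffP existsP) => [[e /andP[? ?]]|[e ? ?]]; exists e => //.
exact/andP.
Qed.

Lemma support_add m1 m2 : support (add m1 m2) = support m1 :|: support m2.
Proof.
apply/setP => x; rewrite finset.in_setU; apply/in_supportP/orP.
  move=> [e xe]; rewrite ffunE addn_gt0 => /orP[h|h]; [left|right];
    by apply/in_supportP; exists e.
by case=> /in_supportP[e xe h]; exists e => //; rewrite ffunE addn_gt0 h ?orbT.
Qed.

Lemma support0 : support (current0 n) = finset.set0.
Proof.
apply/setP => x; rewrite finset.in_set0; apply/negP => /in_supportP[e _].
by rewrite ffunE.
Qed.

Lemma degree_add m1 m2 x : degree (add m1 m2) x = (degree m1 x + degree m2 x)%N.
Proof. by rewrite /degree -big_split/=; apply: eq_bigr => e _; rewrite ffunE. Qed.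

Lemma in_sources m x : (x \in sources m) = odd (degree m x).
Proof. by rewrite inE. Qed.

Lemma in_sources_add m1 m2 x :
  (x \in sources (add m1 m2)) = (x \in sources m1) (+) (x \in sources m2).
Proof. by rewrite !in_sources degree_add oddD. Qed.

Lemma in_sources0 x : (x \in sources (current0 n)) = false.
Proof. by rewrite in_sources /degree big1// => e _; rewrite ffunE. Qed.

Lemma sources_support m x : x \in sources m -> x \in support m.
Proof.
apply: contraTT => xm; rewrite in_sources /degree big1// => e xe.
by apply/eqP; rewrite -leqn0 leqNgt; apply: contra xm => h; apply/in_supportP; exists e.
Qed.

Lemma open_edge_sym m : symmetric (open_edge m).
Proof. by move=> x y; rewrite /open_edge finset.setUC. Qed.

Lemma open_edge_supportl m x y : open_edge m x y -> x \in support m.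
Proof.
move=> /existsP[e /andP[/eqP ee me]]; apply/in_supportP; exists e => //.
by rewrite ee finset.set21.
Qed.

Lemma open_edge_supportr m x y : open_edge m x y -> y \in support m.
Proof. by rewrite open_edge_sym; exact: open_edge_supportl. Qed.

Lemma open_edge_add m1 m2 x y :
  open_edge (add m1 m2) x y = open_edge m1 x y || open_edge m2 x y.
Proof.
apply/existsP/orP.
  move=> [e /andP[ee]]; rewrite ffunE addn_gt0 => /orP[h|h]; [left|right];
    by apply/existsP; exists e; rewrite ee.
by case=> /existsP[e /andP[ee h]]; exists e; rewrite ee ffunE addn_gt0 h ?orbT.
Qed.

Lemma connected_sym m : symmetric (connected_in m).
Proof. exact/sym_connect_sym/open_edge_sym. Qed.

Lemma connected_addl m1 m2 x y :
  connected_in m1 x y -> connected_in (add m1 m2) x y.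
Proof.
apply: connect_sub => a b ab; apply: connect1; by rewrite open_edge_add ab.
Qed.

Lemma connected_addr m1 m2 x y :
  connected_in m2 x y -> connected_in (add m1 m2) x y.
Proof. rewrite current_addC; exact: connected_addl. Qed.

Lemma connected_invariant (T : eqType) (f : 'I_n -> T) m x y :
  (forall a b, open_edge m a b -> f a = f b) -> connected_in m x y -> f x = f y.
Proof.
move=> h /connectP[p + ->]; elim: p x => //= z p ih x /andP[xz /ih <-].
exact: h.
Qed.

Definition edge_current x y : current n :=
  [ffun e => (val e == [set x; y]%SET : nat)].

Fixpoint path_current x p : current n :=
  if p is y :: p' then add (edge_current x y) (path_current y p') else (current0 n).

Lemma edge_current_sym x y : edge_current x y = edge_current y x.
Proof. by apply/ffunP => e; rewrite !ffunE finset.setUC. Qed.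

Lemma open_edge_edge_current x y a b :
  open_edge (edge_current x y) a b -> [set a; b]%SET = [set x; y]%SET.
Proof. by move=> /existsP[e /andP[/eqP <-]]; rewrite ffunE lt0b => /eqP. Qed.

Lemma open_edge_edge x y : x != y -> open_edge (edge_current x y) x y.
Proof.
by move=> xy; apply/existsP; exists (pair_edge xy); rewrite ffunE /= eqxx.
Qed.

Lemma support_edge_current x y : support (edge_current x y) \subset [set x; y]%SET.
Proof.
apply/fintype.subsetP => z /in_supportP[e ze]; rewrite ffunE lt0b => /eqP <-.
exact: ze.
Qed.

Lemma support_path_current x p z : z \in support (path_current x p) -> z \in x :: p.
Proof.
elim: p x => [|y p ih] x /=; first by rewrite support0 finset.in_set0.
rewrite support_add finset.in_setU => /orP[|/ih h]; last by rewrite inE h orbT.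
move=> /(fintype.subsetP (support_edge_current x y)).
by rewrite finset.in_set2 !inE => /orP[->|->]; rewrite ?orbT.
Qed.

Lemma path_current_cat x p q :
  path_current x (p ++ q) = add (path_current x p) (path_current (last x p) q).
Proof.
elim: p x => [|y p ih] x /=; first by rewrite current_add0.
by rewrite ih current_addA.
Qed.

Lemma path_current_rev x u y :
  path_current x (rcons u y) = path_current y (rcons (rev u) x).
Proof.
elim: u x y => [|z u ih] x y /=.
  by rewrite !current_addr0 edge_current_sym.
rewrite rev_cons -[rcons (rcons _ _) _]cats1 path_current_cat last_rcons -ih /= current_addr0.
by rewrite edge_current_sym current_addC.
Qed.

Lemma path_path_current x p : uniq (x :: p) -> path (open_edge (path_current x p)) x p.
Proof.
elim: p x => // y p ih x /[dup] /andP[xp _] /=.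
rewrite inE negb_or => /andP[/andP[xy _] yp].
rewrite open_edge_add open_edge_edge//=.
apply: sub_path (ih _ yp) => a b ab; by rewrite open_edge_add ab orbT.
Qed.

Lemma connected_path_current x p y : uniq (x :: p) -> y \in x :: p ->
  connected_in (path_current x p) x y.
Proof.
move=> /path_path_current h; rewrite inE => /predU1P[->|yp]; first exact: connect0.
move: h; case/path.splitP: yp => p1 p2; rewrite cat_path => /andP[h _].
apply/connectP; exists (rcons p1 y) => //; by rewrite last_rcons.
Qed.

Lemma degree_edge_current x y z : x != y ->
  degree (edge_current x y) z = (z \in [set x; y]%SET).
Proof.
move=> xy; rewrite /degree; case: (boolP (z \in _)) => zxy.
  rewrite (bigD1 (pair_edge xy))//= ffunE eqxx big1// => e /andP[_ exy].
  by rewrite ffunE (_ : _ == _ = false)//; apply: contraNF exy => /eqP ee; exact/eqP/val_inj.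
rewrite big1// => e ze; rewrite ffunE (_ : _ == _ = false)//.
by apply: contraNF zxy => /eqP <-.
Qed.

Lemma in_sources_path_current x p z : uniq (x :: p) ->
  (z \in sources (path_current x p)) = (z == x) (+) (z == last x p).
Proof.
elim: p x => [|y p ih] x; first by rewrite /= in_sources0 addbb.
rewrite cons_uniq inE negb_or => /andP[/andP[xy _] yp].
rewrite [path_current _ _]/= in_sources_add ih// in_sources degree_edge_current//.
rewrite oddb finset.in_set2 /=; have [->|zx] := eqVneq z x.
  by rewrite (negbTE xy).
by case: (z == y); case: (z == last y p).
Qed.

Section weights.
Context (R : realType) (d : R).

Lemma weight_add m1 m2 : (forall e, (m1 e == 0)%N || (m2 e == 0)%N) ->
  weight d (add m1 m2) = weight d m1 * weight d m2.
Proof.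
move=> h; rewrite /weight -big_split/=; apply: eq_bigr => e _; rewrite ffunE.
case/orP: (h e) => /eqP ->; rewrite ?add0n ?addn0 fact0 expr0 invr1.
  by rewrite !mul1r.
by rewrite !mulr1.
Qed.

Lemma weight0 : weight d (current0 n) = 1.
Proof. by rewrite /weight big1// => e _; rewrite ffunE expr0 fact0 invr1 mulr1. Qed.

Lemma weight_edge_current x y : x != y -> weight d (edge_current x y) = d.
Proof.
move=> xy; rewrite /weight (bigD1 (pair_edge xy))//= ffunE eqxx /= big1 ?mulr1.
  by rewrite expr1 invr1 mulr1.
move=> e exy; rewrite ffunE (_ : _ == _ = false) ?expr0 ?fact0 ?invr1 ?mulr1//.
by apply: contraNF exy => /eqP ee; exact/eqP/val_inj.
Qed.

Lemma disjoint_currents m1 m2 (A : {set 'I_n}) :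
  (forall e : edge n, (0 < m1 e)%N -> exists2 x, x \in val e & x \in A) ->
  (forall x, x \in A -> x \notin support m2) ->
  forall e, (m1 e == 0)%N || (m2 e == 0)%N.
Proof.
move=> h dA e; case: (posnP (m1 e)) => [//|/h[x xe xA]].
case: (posnP (m2 e)) => [_|m2e]; first by rewrite orbT.
by move/negP: (dA _ xA); case; apply/in_supportP; exists e.
Qed.

Lemma weight_path_current x p : uniq (x :: p) -> weight d (path_current x p) = d ^+ size p.
Proof.
elim: p x => [|y p ih] x; first by rewrite weight0 expr0.
rewrite cons_uniq => /andP[xyp yp]; rewrite [path_current _ _]/= weight_add.
  rewrite ih// weight_edge_current ?exprS//.
  by move: xyp; rewrite inE negb_or => /andP[].
apply: (@disjoint_currents _ _ [set x]%SET).
  move=> e; rewrite ffunE lt0b => /eqP ->; exists x; first by rewrite finset.set21.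
  by rewrite finset.in_set1.
move=> z; rewrite finset.in_set1 => /eqP ->; apply: contra xyp; exact: support_path_current.
Qed.

End weights.

(** Up to [x] the only open edges are those of the path, so a simple walk that neither returns nor
    stops early is forced along it. After [x] nothing is known, because [dm] may meet the path
    there. *)
Lemma path_current_prefix z v x (dm : current n) w :
  uniq (z :: rcons v x) -> (forall y, y \in z :: v -> y \notin support dm) ->
  path (open_edge (add (path_current z (rcons v x)) dm)) z w ->
  uniq (z :: w) -> last z w \notin z :: v -> exists t, w = rcons v x ++ t.
Proof.
elim: v z w => [|v0 v ih] z [|y w] uz hd; rewrite ?inE ?eqxx//.
- rewrite /= current_addr0 => /andP[+ _] _ _.
  rewrite open_edge_add => /orP[|/open_edge_supportl zd]; last first.
    by have := hd z (mem_head _ _); rewrite zd.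
  move=> /open_edge_edge_current h; have : y \in [set z; x]%SET by rewrite -h finset.set22.
  rewrite finset.in_set2 => /orP[/eqP yz|/eqP ->]; last by exists w.
  have : x \in [set z; y]%SET by rewrite h finset.set22.
  rewrite yz finset.setUid finset.in_set1 => /eqP xz; move: uz; rewrite xz /= inE eqxx.
  by [].
- move=> /=/andP[zy pw] /andP[zyw uw]; rewrite negb_or => /andP[lz lv].
  have yv0 : y = v0.
    move: zy; rewrite !open_edge_add -orbA => /orP[|/orP[|/open_edge_supportl zd]]; last first.
    + by have := hd z (mem_head _ _); rewrite zd.
    + move=> /open_edge_supportl/support_path_current zv.
      by move: uz; rewrite /= zv.
    move=> /open_edge_edge_current h; have : y \in [set z; v0]%SET by rewrite -h finset.set22.
    rewrite finset.in_set2 => /orP[/eqP yz|/eqP //].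
    by move: zyw; rewrite yz mem_head.
  subst y; have [t ->] : exists t, w = rcons v x ++ t; last by exists t.
  apply: (ih v0) => //.
  + by move: uz; rewrite rcons_cons cons_uniq => /andP[].
  + by move=> y yv; apply: hd; rewrite inE yv orbT.
  + apply: (sub_in_path (P := mem (v0 :: w))) pw; last exact/allP.
    move=> a b av bv; rewrite !open_edge_add -orbA => /orP[|//].
    move=> /open_edge_edge_current h.
    have : z \in [set a; b]%SET by rewrite h finset.set21.
    by rewrite finset.in_set2 => /orP[] /eqP zE; move: zyw; rewrite zE ?av ?bv.
Qed.

(* From either end a simple path is forced up to [x], since the other vertices
   meet no edge of [dm]. *)
Lemma path_current_unique a v1 x v2 b (dm : current n) w :
  let u := v1 ++ x :: v2 in
  uniq (a :: rcons u b) -> (forall y, y \in a :: rcons (v1 ++ v2) b -> y \notin support dm) ->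
  path (open_edge (add (path_current a (rcons u b)) dm)) a (rcons w b) ->
  uniq (a :: rcons w b) -> w = u.
Proof.
move=> u uu hd pw uw.
have uE : rcons u b = rcons v1 x ++ rcons v2 b.
  by rewrite /u rcons_cat rcons_cons cat_rcons.
have uE2 : a :: rcons u b = (a :: v1) ++ x :: rcons v2 b.
  by rewrite uE cat_cons cat_rcons.
have := uu; rewrite uE2 cat_uniq => /and3P[uv1 /hasPn v12 uv2].
have bl y : y \in a :: v1 -> y \notin x :: rcons v2 b.
  by move=> yv; apply/negP => /v12; rewrite /= yv.
(* From [a] the part of the path beyond [x] is counted with [dm]; the same argument is then run from
   [b] on the reversed words. *)
have [t1 ht1] : exists t, rcons w b = rcons v1 x ++ t.
  apply: (@path_current_prefix a v1 x (add (path_current x (rcons v2 b)) dm)) => //.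
  - by move: uu; rewrite uE -cat_cons cat_uniq => /andP[].
  - move=> y yv; rewrite support_add finset.in_setU negb_or; apply/andP; split.
      by apply: contra (bl _ yv) => /support_path_current.
    apply: hd; move: yv; rewrite !inE mem_rcons inE mem_cat.
    by case/orP => ->; rewrite ?orbT.
  - by rewrite current_addA -[X in path_current X (rcons v2 b)](last_rcons a v1 x) -path_current_cat -uE.
  - rewrite last_rcons; apply/negP => /bl.
    by rewrite inE mem_rcons mem_head orbT.
have [t2 ht2] : exists t, rcons (rev w) a = rcons (rev v2) x ++ t.
  apply: (@path_current_prefix b (rev v2) x (add (path_current x (rcons (rev v1) a)) dm)) => //.
  - have -> : b :: rcons (rev v2) x = rev (x :: rcons v2 b) by rewrite rev_cons rev_rcons.
    by rewrite rev_uniq.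
  - move=> y yv; have {}yv : y \in rcons v2 b.
      by move: yv; rewrite mem_rcons !inE mem_rev.
    rewrite support_add finset.in_setU negb_or; apply/andP; split.
      apply/negP => /support_path_current.
      rewrite inE mem_rcons inE mem_rev => /predU1P[yx|yv1].
        by move: uv2; rewrite /= -yx yv.
      by have := bl y; rewrite !inE yv1 yv orbT => /(_ isT).
    apply: hd; move: yv; rewrite !inE !mem_rcons !inE mem_cat.
    by case/orP => ->; rewrite ?orbT.
  - rewrite current_addA -[X in path_current X (rcons (rev v1) a)](last_rcons b (rev v2) x).
    rewrite -path_current_cat.
    have -> : rcons (rev v2) x ++ rcons (rev v1) a = rcons (rev u) a.
      by rewrite /u rev_cat rev_cons rcons_cat.
    rewrite -path_current_rev.
    have := pw; rewrite -rev_path last_rcons belast_rcons rev_cons.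
    by apply: sub_path => y z; rewrite open_edge_sym.
  - have -> : b :: rcons (rev w) a = rev (a :: rcons w b) by rewrite rev_cons rev_rcons.
    by rewrite rev_uniq.
  - rewrite last_rcons; apply/negP; rewrite inE mem_rev => ab.
    have := bl a (mem_head _ _); rewrite inE mem_rcons inE.
    by rewrite ab orbT.
have E1 : a :: rcons w b = (a :: v1) ++ x :: t1 by rewrite ht1 cat_rcons.
have E2 : a :: rcons w b = rev t2 ++ x :: rcons v2 b.
  apply: (can_inj revK); rewrite rev_cat rev_cons [rev (rcons w b)]rev_rcons.
  by rewrite [LHS]/= ht2 rev_cons rev_rcons revK.
(* The two factorizations share the pivot [x], which occurs only once, so their tails agree. *)
move: uw; rewrite E1 => /uniq_eqseq_pivotl E3.
have : (a :: v1) ++ x :: t1 == rev t2 ++ x :: rcons v2 b by rewrite -E1 E2.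
rewrite E3 => /andP[_ /eqP t1E].
have := ht1; rewrite t1E -uE => /eqP; rewrite eqseq_rcons => /andP[/eqP].
by [].
Qed.

End current_algebra.

(** * Backbones *)

Section backbones.
Context (n m : nat) (I : finType) (v : I -> 'I_n) (L : eqType) (lab : I -> L).
Hypotheses (v_inj : injective v) (m_gt0 : (0 < m)%N).
Implicit Types (T : {set I}) (c : current n) (x y z : 'I_n).

Definition marked_set : {set 'I_n} := [set v i | i : I]%SET.

Lemma marked_setP x : reflect (exists i, x = v i) (x \in marked_set).
Proof. by apply: (iffP imsetP) => [[i _ ->]|[i ->]]; exists i. Qed.

(** [backbone_marked] keeps the other marks free for later pairs. [backbone_card] bounds the cost of
    avoiding the backbone, and [backbone_reach] lets it be recovered from a sum. [backbone_same] and
    [backbone_colour] say that the induced partition is that of the labels, a colouring constant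
    along open edges being a certificate that blocks are separated. [backbone_size] provides enough
    vertices at which a new path can meet the component of its block. *)
Record backbone T c : Prop := Backbone {
  backbone_sources : sources c = [set v i | i in T]%SET;
  backbone_marked : forall i, v i \in support c -> i \in T;
  backbone_card : (#|support c| <= #|T| * (2 * m))%N;
  backbone_reach : forall x, x \in support c -> exists2 i, i \in T & connected_in c (v i) x;
  backbone_same : forall i j, i \in T -> j \in T -> lab i = lab j ->
    connected_in c (v i) (v j);
  backbone_colour : exists2 col : 'I_n -> L,
    (forall x y, open_edge c x y -> col x = col y) & (forall i, i \in T -> col (v i) = lab i);
  backbone_size : forall i, i \in T ->
    (m <= #|[set x | x \notin marked_set & connected_in c (v i) x]%SET|)%N
}.

Lemma backbone0 (l : L) : backbone finset.set0 (current0 n).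
Proof.
split=> [|i|||||i]; rewrite ?support0 ?cards0 ?finset.in_set0//.
- apply/setP => x; rewrite in_sources0; apply/esym/negbTE/negP => /imsetP[i].
  by rewrite finset.in_set0.
- by move=> x; rewrite finset.in_set0.
- by move=> i j; rewrite finset.in_set0.
- exists (fun=> l) => // i; by rewrite finset.in_set0.
Qed.

Definition extension (a b : I) c (u : seq 'I_n) : current n :=
  current_add (path_current (v a) (rcons u (v b))) c.

(* The last condition says that [x] belongs to the component of the block [l],
   unless no source of this block is present yet, in which case [x] is fresh. *)
Inductive admissible T (l : L) c : seq 'I_n -> Prop :=
  Admissible v1 x v2 of uniq (v1 ++ x :: v2)
  & (forall y, y \in v1 ++ x :: v2 -> y \notin marked_set)
  & (forall y, y \in v1 ++ v2 -> y \notin support c)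
  & (m <= size v1 + size v2 < 2 * m)%N
  & ((exists t, [/\ t \in T, lab t = l & connected_in c (v t) x]) \/
     ((forall t, t \in T -> lab t != l) /\ x \notin support c))
  : admissible T l c (v1 ++ x :: v2).

Section extension.
Context (T : {set I}) (a b : I) (c : current n) (v1 : seq 'I_n) (x : 'I_n)
  (v2 : seq 'I_n).
Let u := v1 ++ x :: v2.
Hypotheses (aT : a \notin T) (bT : b \notin T) (ab : a != b) (lab_ab : lab a = lab b)
  (cT : backbone T c) (u_uniq : uniq u)
  (u_unmarked : forall y, y \in u -> y \notin marked_set)
  (u_fresh : forall y, y \in v1 ++ v2 -> y \notin support c)
  (u_size : (m <= size v1 + size v2 < 2 * m)%N)
  (x_spec : (exists t, [/\ t \in T, lab t = lab a & connected_in c (v t) x]) \/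
     ((forall t, t \in T -> lab t != lab a) /\ x \notin support c)).
Let q := path_current (v a) (rcons u (v b)).
Let p := v a :: rcons u (v b).

Lemma extension_mem_path y : (y \in p) = [|| y == v a, y == v b | y \in u].
Proof. by rewrite inE mem_rcons inE. Qed.

Lemma extension_path_uniq : uniq p.
Proof.
have nu i : v i \notin u.
  by apply/negP => /u_unmarked/negP; apply; apply/marked_setP; exists i.
by rewrite /p cons_uniq rcons_uniq mem_rcons inE negb_or !nu u_uniq (inj_eq v_inj) ab.
Qed.

Lemma extension_ends y : y \in [:: v a; v b] -> y \notin support c.
Proof.
have h i : i \notin T -> v i \notin support c.
  by apply: contra; exact: (backbone_marked cT).
by rewrite mem_seq2 => /orP[] /eqP ->; exact: h.
Qed.

Lemma extension_path_fresh y : y \in p -> y != x -> y \notin support c.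
Proof.
rewrite extension_mem_path => /or3P[/eqP ->|/eqP ->|yu] yx.
- by apply: extension_ends; rewrite mem_head.
- by apply: extension_ends; rewrite !inE eqxx orbT.
- apply: u_fresh; move: yu; rewrite /u !mem_cat inE (negbTE yx); exact.
Qed.

Lemma extension_fresh_seq y : y \in v a :: rcons (v1 ++ v2) (v b) -> y \notin support c.
Proof.
rewrite inE mem_rcons inE => /or3P[/eqP ->|/eqP ->|/u_fresh//].
- by apply: extension_ends; rewrite mem_head.
- by apply: extension_ends; rewrite !inE eqxx orbT.
Qed.

Lemma extension_path_connected y : y \in p -> connected_in (extension a b c u) (v a) y.
Proof.
by move=> yp; apply/connected_addl/connected_path_current => //; exact: extension_path_uniq.
Qed.

Lemma extension_path_connected2 y z : y \in p -> z \in p ->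
  connected_in (extension a b c u) y z.
Proof.
move=> yp zp; apply: (@connect_trans _ _ (v a)); last exact: extension_path_connected.
by rewrite -/(connected_in _ _ _) connected_sym extension_path_connected.
Qed.

Lemma extension_supportP y :
  y \in support (extension a b c u) -> (y \in p) || (y \in support c).
Proof.
rewrite support_add finset.in_setU => /orP[/support_path_current ->//|->].
by rewrite orbT.
Qed.

Lemma insertion_in_path : x \in p.
Proof. by rewrite extension_mem_path mem_cat mem_head !orbT. Qed.

Lemma a_in_path : v a \in p. Proof. exact: mem_head. Qed.

Lemma b_in_path : v b \in p.
Proof. by rewrite extension_mem_path eqxx orbT. Qed.

Lemma extension_same_old t : t \in T -> lab t = lab a ->
  connected_in (extension a b c u) (v t) (v a).
Proof.
move=> tT tl; case: x_spec => [[t' [t'T t'l t'x]]|[h _]]; last first.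
  by have := h _ tT; rewrite tl eqxx.
apply: (@connect_trans _ _ x); last exact/extension_path_connected2/a_in_path/insertion_in_path.
apply: connected_addr; apply: connect_trans t'x.
by apply: (backbone_same cT) => //; rewrite tl t'l.
Qed.

Lemma extension_same_new i t : i \in [set a; b]%SET -> t \in a |: (b |: T) ->
  lab i = lab t -> connected_in (extension a b c u) (v i) (v t).
Proof.
move=> iab; have ip : v i \in p.
  by move: iab; rewrite finset.in_set2 => /orP[] /eqP ->; rewrite ?a_in_path ?b_in_path.
have il : lab i = lab a by move: iab; rewrite finset.in_set2 => /orP[] /eqP ->.
rewrite !finset.in_setU1 => /or3P[/eqP ->|/eqP ->|tT] h.
- exact/extension_path_connected2/a_in_path.
- exact/extension_path_connected2/b_in_path.
- apply: (@connect_trans _ _ (v a)); first exact/extension_path_connected2/a_in_path.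
  rewrite -/(connected_in _ _ _) connected_sym; apply: extension_same_old => //.
  by rewrite -h.
Qed.

Lemma in_setU1U1 i : (i \in a |: (b |: T)) = (i \in [set a; b]%SET) || (i \in T).
Proof. by rewrite !finset.in_setU1 !finset.in_set1 orbA. Qed.

Lemma extension_sources :
  sources (extension a b c u) = [set v i | i in a |: (b |: T)]%SET.
Proof.
apply/setP => z; rewrite in_sources_add in_sources_path_current ?extension_path_uniq//.
rewrite last_rcons (backbone_sources cT) !imsetU1 !finset.in_setU1.
have nT i : i \notin T -> v i \notin [set v j | j in T]%SET.
  by apply: contra; rewrite mem_imset.
have [->|za] := eqVneq z (v a).
  by rewrite (negbTE (nT _ aT)) (inj_eq v_inj) (negbTE ab).
by have [->|zb] := eqVneq z (v b); first by rewrite (negbTE (nT _ bT)).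
Qed.

Lemma card_setU1U1 : #|a |: (b |: T)| = #|T|.+2.
Proof. by rewrite !cardsU1 finset.in_setU1 negb_or ab aT bT. Qed.

Lemma backbone_extension : backbone (a |: (b |: T)) (extension a b c u).
Proof.
split.
- exact: extension_sources.
- move=> i /extension_supportP/orP[|/(backbone_marked cT) iT]; last first.
    by rewrite in_setU1U1 iT orbT.
  rewrite extension_mem_path !(inj_eq v_inj) => /or3P[/eqP ->|/eqP ->|/u_unmarked].
  + by rewrite finset.in_setU1 eqxx.
  + by rewrite !finset.in_setU1 eqxx orbT.
  + by move=> /negP; case; apply/marked_setP; exists i.
- rewrite card_setU1U1.
  have sub : support (extension a b c u) \subset [set y in p]%SET :|: support c.
    by apply/fintype.subsetP => y /extension_supportP h; rewrite finset.in_setU finset.in_set.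
  apply: leq_trans (subset_leq_card sub) _; apply: leq_trans (leq_card_setU _ _) _.
  rewrite cardsE; have h1 : (#|p| <= 2 * m + 2)%N.
    apply: leq_trans (card_size _) _.
    by rewrite /= size_rcons /u size_cat /=; move: u_size; lia.
  apply: leq_trans (leq_add h1 (backbone_card cT)) _.
  by move: m_gt0; rewrite !mulSn; lia.
- move=> y /extension_supportP/orP[yp|].
    exists a; first by rewrite finset.in_setU1 eqxx.
    exact: extension_path_connected.
  move=> /(backbone_reach cT)[i iT h]; exists i; first by rewrite in_setU1U1 iT orbT.
  exact: connected_addr.
- move=> i j; rewrite in_setU1U1 => /orP[iab|iT]; first exact: extension_same_new.
  rewrite in_setU1U1 => /orP[jab|jT] h.
    rewrite connected_sym; apply: extension_same_new => //; by rewrite in_setU1U1 iT orbT.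
  exact/connected_addr/(backbone_same cT).
- have [col col_edge colT] := backbone_colour cT.
  (* The new path takes the label of its ends. It can meet the old support only at [x], which then
     already has this colour. *)
  pose col' z := if z \in p then lab a else col z.
  have col'E z : z \in support c -> col' z = col z.
    move=> zc; rewrite /col'; case: ifPn => // zp.
    have zx : z = x by apply/eqP; apply: contraTT zc; exact: extension_path_fresh.
    subst z; case: x_spec => [[t [tT tl tx]]|[_]]; last by rewrite zc.
    by rewrite -(connected_invariant col_edge tx) colT// tl.
  exists col'.
    move=> y z; rewrite open_edge_add => /orP[h|h].
      have := support_path_current (open_edge_supportl h).
      have := support_path_current (open_edge_supportr h).
      by rewrite -/p /col' => -> ->.
    have [yc zc] := (open_edge_supportl h, open_edge_supportr h).
    by rewrite (col'E _ yc) (col'E _ zc); exact: col_edge.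
  move=> i; rewrite in_setU1U1 => /orP[|iT].
    rewrite finset.in_set2 /col' => /orP[] /eqP ->.
      by rewrite a_in_path.
    by rewrite b_in_path.
  rewrite -(colT _ iT); apply: col'E; apply: sources_support.
  by rewrite (backbone_sources cT) mem_imset.
- move=> i; rewrite in_setU1U1 => /orP[iab|iT]; last first.
    apply: leq_trans (backbone_size cT iT) _; apply/subset_leq_card/fintype.subsetP => y.
    by rewrite !inE => /andP[-> h]/=; exact: connected_addr.
  have ip : v i \in p.
    by move: iab; rewrite finset.in_set2 => /orP[] /eqP ->; rewrite ?a_in_path ?b_in_path.
  have sub : [set y in u]%SET \subset
      [set y | y \notin marked_set & connected_in (extension a b c u) (v i) y]%SET.
    apply/fintype.subsetP => y; rewrite !inE => yu; rewrite u_unmarked//=.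
    by apply: extension_path_connected2 => //; rewrite extension_mem_path yu !orbT.
  apply: leq_trans _ (subset_leq_card sub); rewrite cardsE (card_uniqP u_uniq).
  by rewrite size_cat /=; move: u_size; lia.
Qed.

Lemma weight_extension (R : realType) (d : R) :
  weight d (extension a b c u) = d ^+ (size u).+1 * weight d c.
Proof.
rewrite weight_add ?weight_path_current ?extension_path_uniq ?size_rcons//.
(* An edge of the path has an end other than [x], and this end is outside the support of [c]; the
   two currents therefore share no edge and the weights multiply. *)
apply: (@disjoint_currents _ _ _ [set y in p | y != x]%SET).
  move=> e qe; have := cardsD1 x (val e); rewrite (eqP (valP e)) => e2.
  have : (0 < #|val e :\ x|)%N by rewrite -(ltn_add2l (x \in val e)) -e2 addn0; case: (_ \in _).
  move=> /card_gt0P[y]; rewrite finset.in_setD1 => /andP[yx ye]; exists y => //.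
  by rewrite inE yx andbT; apply: support_path_current; apply/in_supportP; exists e.
by move=> y; rewrite inE => /andP[]; exact: extension_path_fresh.
Qed.

(** Different pairs of a backbone and a path yield different extensions, so the weights in the
    inductive construction add up without overcounting: [u'] is a simple path in the graph of the
    second extension, hence forced to be [u]. *)
Lemma extension_unique u' c' : uniq (v a :: rcons u' (v b)) ->
  extension a b c' u' = extension a b c u -> u' = u /\ c' = c.
Proof.
move=> uu' E.
have u'u : u' = u.
  apply: (@path_current_unique _ (v a) v1 x v2 (v b) c) => //.
  - exact: extension_path_uniq.
  - exact: extension_fresh_seq.
  - rewrite -/u -/(extension a b c u) -E.
    apply: sub_path (path_path_current uu') => y z yz.
    by rewrite open_edge_add yz.
split=> //; move: E; rewrite u'u /extension ![current_add (path_current _ _) _]current_addC.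
exact: current_addIr.
Qed.

End extension.
End backbones.

(** * Words with one distinguished vertex inserted *)

Section insertions.
Context (T : finType).
Implicit Types (F X : {set T}) (w u : seq T) (x : T).

Definition words F (l : nat) : seq (seq T) :=
  [seq val t | t <- enum [set t : l.-tuple T | all (mem F) t & uniq t]%SET].

Lemma wordsP F l w :
  reflect [/\ size w = l, {subset w <= F} & uniq w] (w \in words F l).
Proof.
apply: (iffP mapP) => [[t + ->]|[sw /allP wF uw]].
  by rewrite mem_enum inE => /andP[/allP h1 h2]; rewrite size_tuple.
exists (Tuple (introT eqP sw)) => //.
by rewrite mem_enum inE /= wF uw.
Qed.

Lemma words_uniq F l : uniq (words F l).
Proof. by rewrite map_inj_uniq ?enum_uniq//; exact: val_inj. Qed.

Lemma size_words F l : size (words F l) = #|F| ^_ l.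
Proof. by rewrite size_map -cardE card_uniq_tuples. Qed.

Definition word_range F (m : nat) : seq (seq T) :=
  flatten [seq words F l | l <- iota m m].

Lemma word_rangeP F m w :
  reflect [/\ (m <= size w < 2 * m)%N, {subset w <= F} & uniq w] (w \in word_range F m).
Proof.
rewrite /word_range; apply: (iffP flatten_mapP) => [[l]|[sw wF uw]].
  by rewrite mem_iota => lm /wordsP[-> ? ?]; split=> //; lia.
by exists (size w); [rewrite mem_iota; lia|apply/wordsP].
Qed.

Lemma word_range_uniq F m : uniq (word_range F m).
Proof.
rewrite /word_range; elim: (iota m m) (iota_uniq m m) => //= l s ih /andP[ls us].
rewrite cat_uniq words_uniq ih// andbT; apply/hasPn => w /flatten_mapP[l' l's].
move=> /wordsP[sw _ _]; apply/negP => /wordsP[sw' _ _].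
by move: ls; rewrite -sw' sw l's.
Qed.

Definition insertion w (p : nat * T) : seq T := take p.1 w ++ p.2 :: drop p.1 w.

(** Positions below [m] lie inside every word of the range, so the number of positions does not
    depend on the word. *)
Definition insertions F X (m : nat) : seq (seq T) :=
  [seq insertion w p | w <- word_range F m, p <- [seq (i, x) | i <- iota 0 m, x <- enum X]].

Lemma insertionsP F X m u : [disjoint F & X]%B -> u \in insertions F X m ->
  exists v1 x v2, [/\ u = v1 ++ x :: v2, uniq u, {subset v1 ++ v2 <= F}, x \in X &
    (m <= size v1 + size v2 < 2 * m)%N].
Proof.
move=> FX /allpairsP[[w [i x]] /= [/word_rangeP[sw wF uw] /allpairsP[[i' x'] /= [ii xX [-> ->]]] ->]].
rewrite mem_enum in xX.
have xF : x' \notin F by move: FX; rewrite disjoint_sym => /pred0P/(_ x'); rewrite /= xX /= => ->.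
exists (take i' w), x', (drop i' w); split=> //; last 2 first.
- by rewrite cat_take_drop.
- by rewrite -size_cat cat_take_drop.
- rewrite /insertion /= uniq_catC /= uniq_catC cat_take_drop uw andbT.
  by rewrite mem_cat orbC -mem_cat cat_take_drop; apply: contra xF; exact: wF.
Qed.

(** The inserted vertex is the only letter outside [F], so its position and the original word can be
    read off from the result. *)
Lemma insertions_uniq F X m : [disjoint F & X]%B -> uniq (insertions F X m).
Proof.
move=> FX; apply: allpairs_uniq.
- exact: word_range_uniq.
- by apply: allpairs_uniq; rewrite ?iota_uniq ?enum_uniq// => -[? ?] [? ?] _ _ [-> ->].
move=> [w [i x]] [w' [i' x']] /allpairsP[[w0 [i0 x0]] /= [/word_rangeP[sw wF _] + [-> -> ->]]].
move=> /allpairsP[[i1 x1] /= [im xX [-> ->]]].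
move=> /allpairsP[[w0' [i0' x0']] /= [/word_rangeP[sw' wF' _] + [-> -> ->]]].
move=> /allpairsP[[i1' x1'] /= [im' xX' [-> ->]]].
rewrite /insertion /= => E.
have hF y : y \in X -> y \notin F.
  by move=> yX; move: FX; rewrite disjoint_sym => /pred0P/(_ y); rewrite /= yX /= => ->.
have find_eq j y (z : seq T) : (j < m)%N -> (m <= size z)%N -> {subset z <= F} -> y \in X ->
    find (predC (mem F)) (take j z ++ y :: drop j z) = j.
  move=> jm mz zF yX; rewrite find_cat ifN; last first.
    by apply/hasPn => t /mem_take/zF tF; rewrite /= tF.
  by rewrite /= hF// addn0 size_takel// ltnW// (leq_trans jm).
rewrite !mem_iota in im im'; rewrite !mem_enum in xX xX'.
have ii : i1 = i1'.
  rewrite -(find_eq i1 x1 w0)//; last by case/andP: sw.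
  by rewrite E find_eq//; case/andP: sw'.
subst i1'; move/eqP: E; rewrite eqseq_cat; last first.
  have /andP[mw _] := sw; have /andP[mw' _] := sw'.
  by rewrite !size_takel// ltnW// (leq_trans im).
rewrite eqseq_cons => /and3P[/eqP t1 /eqP -> /eqP t2].
by rewrite -(cat_take_drop i1 w0) t1 t2 cat_take_drop.
Qed.

Lemma sum_insertions (R : realType) (d : R) F X m :
  \sum_(u <- insertions F X m) d ^+ (size u).+1 =
  m%:R * #|X|%:R * d ^+ 2 * \sum_(l <- iota m m) (#|F| ^_ l)%:R * d ^+ l.
Proof.
rewrite /insertions big_allpairs_dep/=.
rewrite (eq_bigr (fun w => m%:R * #|X|%:R * d ^+ 2 * d ^+ size w)); last first.
  move=> w _; rewrite (eq_bigr (fun=> d ^+ 2 * d ^+ size w)).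
    rewrite big_const_seq count_predT size_allpairs size_iota -cardE iter_addr_0.
    by rewrite -[LHS]mulr_natl natrM !mulrA.
  (* A word of length $l$ gives $l+1$ inner vertices, hence a path of $l+2$ edges. *)
  move=> [i x] _; rewrite /insertion /= size_cat /= addnS -size_cat cat_take_drop.
  by rewrite -exprD add2n.
rewrite -big_distrr/=; congr (_ * _); rewrite /word_range.
elim: (iota m m) => [|l s ih]; first by rewrite !big_nil.
rewrite /= big_cat big_cons ih; congr (_ + _).
rewrite big_seq (eq_bigr (fun=> d ^+ l)); last by move=> w /wordsP[-> _ _].
by rewrite -big_seq big_const_seq count_predT size_words iter_addr_0 mulr_natl.
Qed.

End insertions.

(** * Lower bound on the weight of the new paths *)

Section counting.
Context (R : realType).

Lemma expR_le_oneB (y : R) : 0 <= y <= 2^-1 -> expR (- (2 * y)) <= 1 - y.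
Proof.
move=> /andP[y0 y1]; rewrite expRN.
have h := expR_ge1Dx (2 * y).
apply: (@le_trans _ _ (1 + 2 * y)^-1).
  by rewrite lef_pV2 ?posrE ?expR_gt0//; lra.
rewrite -div1r ler_pdivrMr; nra.
Qed.

Lemma expn_le_ffactB (f l : nat) : ((f - l) ^ l <= f ^_ l)%N.
Proof.
rewrite ffact_prod -[X in (_ ^ X)%N](card_ord l) -prod_nat_const.
by apply: leq_prod => i _; have := ltn_ord i; lia.
Qed.

Lemma window_d_ge (L : R) n m d : critical_window L n m d -> (8 * m%:R ^+ 2)^-1 <= d.
Proof.
move=> W; have n0 := window_nR_gt0 W; have [_ n2] := window_nR W.
have m1 := window_mR_ge1 W; case: W => _ _ _ _ /andP[h _].
apply: (@le_trans _ _ (2^-1 / n%:R)); last by rewrite ler_pdivrMr.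
rewrite -invfM lef_pV2 ?posrE ?mulr_gt0 ?exprn_gt0 ?(lt_le_trans ltr01 m1)//.
lra.
Qed.

Lemma ffact_weight_lower (L : R) (K : nat) : 0 <= L ->
  exists2 c, 0 < c & exists m0, forall n m d f l, critical_window L n m d ->
    (m0 <= m)%N -> (n <= f + K * m)%N -> (l < 2 * m)%N ->
    c <= (f ^_ l)%:R * d ^+ l.
Proof.
move=> L0; pose q : R := L + K%:R + 2.
have q0 : 0 <= q by rewrite !addr_ge0.
exists (expR (- (4 * q))); first exact: expR_gt0.
(* The two bounds ensure $q/m \le 1/2$ and $(K+2)/m \le 1$. *)
exists (maxn (Num.bound (2 * q)) (K + 2)) => n m d f l W.
rewrite geq_max => /andP[mq mK] nf lm.
have m1 := window_mR_ge1 W; have mR0 : 0 < m%:R :> R by rewrite (lt_le_trans ltr01).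
have n0 := window_nR_gt0 W; have [n1 _] := window_nR W; have d0 := window_d_gt0 W.
have [_ mn _ eps _] := W.
have qm : 2 * q <= m%:R.
  have := archi_boundP (mulr_ge0 (ler0n R 2) q0); move=> /ltW/le_trans; apply.
  by rewrite ler_nat.
have lf : (l <= f)%N by nia.
have base : 1 - q / m%:R <= (f - l)%:R * d.
  have fl : n%:R - (K + 2)%:R * m%:R <= (f - l)%:R :> R.
    by rewrite lerBlDr -natrM -natrD ler_nat; lia.
  apply: le_trans (ler_wpM2r (ltW d0) fl).
  have e1 : 1 - L / m%:R <= d * n%:R.
    by move: eps; rewrite ler_norml => /andP[_]; lra.
  have e2 : (K + 2)%:R * m%:R * d <= (K + 2)%:R / m%:R * (d * n%:R).
    rewrite (_ : _ / _ * _ = (K + 2)%:R * (n%:R / m%:R) * d); last by ring.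
    by rewrite ler_pM2r// ler_wpM2l// ler_pdivlMr// -expr2.
  have y1 : (K + 2)%:R / m%:R <= 1 :> R by rewrite ler_pdivrMr// mul1r ler_nat.
  have y0 : 0 <= (K + 2)%:R / m%:R :> R by rewrite divr_ge0.
  have z0 : 0 <= L / m%:R by rewrite divr_ge0.
  rewrite mulrBl [n%:R * d]mulrC; move: e1 e2 y1 y0 z0.
  have -> : q / m%:R = L / m%:R + (K + 2)%:R / m%:R by rewrite /q natrD; ring.
  move: (L / m%:R) ((K + 2)%:R / m%:R) (d * n%:R) => z y s.
  move=> e1 e2 y1 y0 z0; nra.
have y01 : 0 <= q / m%:R <= 2^-1.
  rewrite divr_ge0//= ler_pdivrMr//; lra.
have base2 := le_trans (expR_le_oneB y01) base.
apply: (@le_trans _ _ (((f - l)%:R * d) ^+ l)); last first.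
  rewrite exprMn ler_wpM2r ?exprn_ge0 ?(ltW d0)// -natrX ler_nat.
  exact: expn_le_ffactB.
apply: (@le_trans _ _ (expR (- (2 * (q / m%:R))) ^+ l)); last first.
  by rewrite lerXn2r ?nnegrE ?expR_ge0// (le_trans (expR_ge0 _) base2).
rewrite -expRM_natl ler_expR mulrN lerN2.
rewrite (_ : 4 * q = (2 * m%:R) * (2 * (q / m%:R))); last by field; rewrite gt_eqF.
rewrite ler_wpM2r//; first by rewrite mulr_ge0//; case/andP: y01.
by rewrite -natrM ler_nat ltnW.
Qed.

(** There are [m] lengths, [m] positions and [m] choices of the inserted vertex, against $d^2 \ge
    1/(64m^4)$. *)
Lemma sum_insertions_lower (L : R) (K : nat) : 0 <= L ->
  exists2 c, 0 < c & exists m0, forall n m d (F X : {set 'I_n}),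
    critical_window L n m d ->
    (m0 <= m)%N -> (n <= #|F| + K * m)%N -> #|X| = m ->
    c / m%:R <= \sum_(u <- insertions F X m) d ^+ (size u).+1.
Proof.
move=> L0; have [c c0 [m0 h]] := ffact_weight_lower K L0.
exists (c / 64); first by rewrite divr_gt0.
exists m0 => n m d F X W mm nF Xm; rewrite sum_insertions Xm.
have m1 := window_mR_ge1 W; have mR0 : 0 < m%:R :> R by rewrite (lt_le_trans ltr01).
have d0 := window_d_gt0 W.
have S : m%:R * c <= \sum_(l <- iota m m) (#|F| ^_ l)%:R * d ^+ l.
  apply: (@le_trans _ _ (\sum_(l <- iota m m) c)).
    by rewrite big_const_seq count_predT size_iota iter_addr_0 mulr_natl.
  rewrite big_seq [leRHS]big_seq; apply: ler_sum => l.
  by rewrite mem_iota => lm; apply: (h n m) => //; lia.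
have d2 : (64 * m%:R ^+ 4)^-1 <= d ^+ 2.
  rewrite (_ : _^-1 = (8 * m%:R ^+ 2)^-1 ^+ 2); last by field; rewrite gt_eqF.
  rewrite lerXn2r ?nnegrE ?invr_ge0 ?mulr_ge0 ?exprn_ge0 ?(ltW d0)//.
  exact: (window_d_ge W).
apply: (@le_trans _ _ (m%:R * m%:R * (64 * m%:R ^+ 4)^-1 * (m%:R * c))).
  by rewrite le_eqVlt; apply/orP; left; apply/eqP; field; rewrite gt_eqF.
have m2 : 0 <= m%:R * m%:R :> R by rewrite -expr2 sqr_ge0.
have m4 : 0 <= (64 * m%:R ^+ 4)^-1 :> R by rewrite invr_ge0 mulr_ge0 ?exprn_ge0.
have mc : 0 <= m%:R * c by rewrite mulr_ge0// ltW.
have m24 := mulr_ge0 m2 m4.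
by apply: ler_pM => //; rewrite ler_wpM2l.
Qed.

End counting.

(** * Inductive construction of families of backbones *)

Section families.
Context (R : realType).

Lemma exists_subset_card (T : finType) (B : {set T}) m : (m <= #|B|)%N ->
  exists2 X : {set T}, X \subset B & #|X| = m.
Proof.
move=> mB; exists [set x in take m (enum B)]%SET.
  by apply/fintype.subsetP => x; rewrite inE => /mem_take; rewrite mem_enum.
rewrite cardsE (card_uniqP _) ?take_uniq ?enum_uniq//.
by rewrite size_takel// -cardE.
Qed.

(** Evenness is stated per label and for subsets, so that it survives the removal of two sources
    with the same label. *)
Definition even_classes (I : finType) (Lb : eqType) (lab : I -> Lb) (T : {set I}) :=
  forall l, ~~ odd #|[set i in T | lab i == l]%SET|.

Lemma even_classes_pair (I : finType) (Lb : eqType) (lab : I -> Lb) (T : {set I}) a :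
  even_classes lab T -> a \in T ->
  exists b, [/\ b \in T, a != b & lab a = lab b].
Proof.
move=> eT aT; have := eT (lab a); rewrite (cardsD1 a) inE aT eqxx /= negbK => o.
have : (0 < #|[set i in T | lab i == lab a] :\ a|)%N by case: #|_| o.
move=> /card_gt0P[b]; rewrite !inE => /and3P[ba bT /eqP lb].
by exists b; rewrite bT eq_sym ba lb.
Qed.

Lemma even_classes_remove (I : finType) (Lb : eqType) (lab : I -> Lb) (T : {set I}) a b :
  even_classes lab T -> a \in T -> b \in T -> a != b -> lab a = lab b ->
  even_classes lab (T :\ a :\ b).
Proof.
move=> eT aT bT ab lab_ab l; have := eT l.
have [la|la] := eqVneq (lab a) l.
  rewrite (cardsD1 a) (cardsD1 b) !inE aT bT la -lab_ab la eqxx eq_sym ab /= negbK.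
  congr (~~ odd _); apply: eq_card => i; rewrite !inE; by rewrite !andbA.
congr (~~ odd _); apply: eq_card => i; rewrite !inE.
have [->|ib] := eqVneq i b; first by rewrite -lab_ab (negbTE la) andbF.
by have [->|ia] := eqVneq i a; first by rewrite (negbTE la) andbF.
Qed.

Lemma insertion_family (L : R) (N : nat) : 0 <= L ->
  exists2 k, 0 < k & exists m0, forall n m d (I : finType) (v : I -> 'I_n)
    (Lb : eqType) (lab : I -> Lb) (T : {set I}) (c : current n) (l : Lb),
    (#|I| <= N)%N -> critical_window L n m d -> (m0 <= m)%N ->
    backbone m v lab T c ->
    exists U : seq (seq 'I_n), [/\ uniq U,
      forall u, u \in U -> admissible m v lab T l c u &
      k / m%:R <= \sum_(u <- U) d ^+ (size u).+1].
Proof.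
(* The forbidden vertices are at most [N] marks, $2Nm$ vertices of the backbone and the [m] vertices
   of [X]. *)
move=> L0; have [k k0 [m0 h]] := sum_insertions_lower (3 * N + 1) L0.
exists k => //; exists (maxn m0 (3 * N + 1)) => n m d I v Lb lab T c l IN W.
rewrite geq_max => /andP[mm0 mN] cT.
have m_gt0 := window_m_gt0 W; have [_ mn _ _ _] := W.
have TN : (#|T| <= N)%N by apply: leq_trans IN; exact: max_card.
have markN : (#|marked_set v| <= N)%N.
  apply: leq_trans (leq_imset_card _ _) _; exact: leq_trans (max_card _) IN.
pose used := marked_set v :|: support c.
have usedN : (#|used| <= 3 * N * m)%N.
  apply: leq_trans (leq_card_setU _ _) _; apply: leq_trans (leq_add markN (backbone_card cT)) _.
  nia.
have cused : (#|used| + #|~: used| = n)%N by rewrite cardsC card_ord.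
have [X [Xm Xmarked Xspec]] : exists X : {set 'I_n}, [/\ #|X| = m,
   {subset X <= ~: marked_set v} & forall x, x \in X ->
    (exists t, [/\ t \in T, lab t = l & connected_in c (v t) x]) \/
     ((forall t, t \in T -> lab t != l) /\ x \notin support c)].
  case: (pickP [pred t | (t \in T) && (lab t == l)]) => [t /andP[/= tT /eqP tl]|noT].
    have [X XB Xm] := exists_subset_card (backbone_size cT tT).
    exists X; split=> // x /(fintype.subsetP XB); rewrite inE => /andP[xm tx].
      by rewrite finset.in_setC.
    by left; exists t.
  have [|X XB Xm] := @exists_subset_card _ (~: used) m; first by nia.
  exists X; split=> // x /(fintype.subsetP XB);
    rewrite finset.in_setC finset.in_setU negb_or => /andP[xm xs].
    by rewrite finset.in_setC.
  right; split=> // t tT; have := noT t; rewrite /= tT /= => ->; by [].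
pose F := ~: (used :|: X).
have FX : [disjoint F & X]%B.
  apply/pred0P => x /=; rewrite finset.in_setC finset.in_setU.
  by case: (x \in X); rewrite ?orbT ?andbF.
exists (insertions F X m); split.
- exact: insertions_uniq.
- move=> u /(insertionsP FX)[v1 [x [v2 [-> u_uniq uF xX um]]]].
  have hF y : y \in F -> (y \notin marked_set v) /\ (y \notin support c).
    by rewrite finset.in_setC !finset.in_setU !negb_or => /andP[/andP[]].
  apply: Admissible => //.
  + move=> y; rewrite mem_cat inE => /or3P[yv|/eqP ->|yv].
    * by have [] : _ := hF y _; first by apply: uF; rewrite mem_cat yv.
    * by have := Xmarked _ xX; rewrite finset.in_setC.
    * by have [] : _ := hF y _; first by apply: uF; rewrite mem_cat yv orbT.
  + by move=> y /uF/hF[].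
  + exact: Xspec.
- apply: h => //.
  have : (#|used :|: X| <= 3 * N * m + m)%N.
    by apply: leq_trans (leq_card_setU _ _) _; rewrite Xm leq_add2r.
  have := cardsC (used :|: X); rewrite card_ord -/F; lia.
Qed.

(** Induction on the number of pairs: two sources with a common label are removed, a family is built
    for the rest, and each of its members is extended by all admissible paths, which multiplies the
    total weight by at least $k/m$. *)
Lemma backbone_family (L : R) (N : nat) : 0 <= L ->
  exists2 k, 0 < k & exists m0, forall n m d (I : finType) (v : I -> 'I_n)
    (Lb : eqType) (lab : I -> Lb) (l0 : Lb) r (T : {set I}),
    injective v -> (#|I| <= N)%N -> critical_window L n m d -> (m0 <= m)%N ->
    #|T| = r.*2 -> even_classes lab T ->
    exists F : seq (current n), [/\ uniq F,
      forall c, c \in F -> backbone m v lab T c &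
      (k / m%:R) ^+ r <= \sum_(c <- F) weight d c].
Proof.
move=> L0; have [k k0 [m0 h]] := insertion_family N L0.
exists k => //; exists m0 => n m d I v Lb lab l0 r T v_inj IN W mm.
have m_gt0 := window_m_gt0 W; have d0 := window_d_gt0 W.
have km : 0 <= k / m%:R by rewrite divr_ge0// ltW.
elim: r T => [|r ih] T Tr eT.
  exists [:: current0 n]; split=> //.
    move=> c; rewrite inE => /eqP ->; have /eqP := Tr; rewrite cards_eq0 => /eqP ->.
    exact: backbone0.
  by rewrite big_seq1 weight0 expr0.
have /card_gt0P[a aT] : (0 < #|T|)%N by rewrite Tr.
have [b [bT ab lab_ab]] := even_classes_pair eT aT.
pose T' := T :\ a :\ b.
have TE : a |: (b |: T') = T.
  by rewrite /T' finset.setD1K ?finset.setD1K// !inE eq_sym ab bT.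
have aT' : a \notin T' by rewrite !inE eqxx /= andbF.
have bT' : b \notin T' by rewrite !inE eqxx.
have T'r : #|T'| = r.*2.
  by have := card_setU1U1 aT' bT' ab; rewrite TE Tr doubleS => -[].
have [F' [uF' F'T sF']] := ih T' T'r (even_classes_remove eT aT bT ab lab_ab).
have /choice[U hU] : forall c : current n, exists U : seq (seq 'I_n), c \in F' ->
    [/\ uniq U, forall u, u \in U -> admissible m v lab T' (lab a) c u &
      k / m%:R <= \sum_(u <- U) d ^+ (size u).+1].
  move=> c; case: (boolP (c \in F')) => cF; last by exists [::].
  by have [U hU] := h n m d I v Lb lab T' c (lab a) IN W mm (F'T _ cF); exists U.
exists [seq extension v a b c u | c <- F', u <- U c]; split.
- apply: allpairs_uniq_dep => //; first by move=> c /hU[].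
  move=> _ _ /allpairsPdep[c [u [cF uU ->]]] /allpairsPdep[c' [u' [cF' uU' ->]]] /= E.
  have [_ /(_ _ uU) adm _] := hU _ cF; have [_ /(_ _ uU') adm' _] := hU _ cF'.
  have uq : uniq (v a :: rcons u (v b)).
    by case: adm => v1 x v2 h1 h2 h3 h4 h5; apply: (extension_path_uniq v_inj ab h1 h2).
  case: adm' E => v1 x v2 h1 h2 h3 h4 h5 E.
  by have [-> ->] := extension_unique v_inj aT' bT' ab (F'T _ cF') h1 h2 h3 uq E.
- move=> _ /allpairsPdep[c [u [cF uU ->]]].
  have [_ /(_ _ uU) adm _] := hU _ cF.
  case: adm => v1 x v2 h1 h2 h3 h4 h5; rewrite -TE.
  by apply: backbone_extension => //; exact: F'T.
- rewrite big_allpairs_dep/= exprSr.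
  apply: (@le_trans _ _ (\sum_(c <- F') weight d c * (k / m%:R))).
    by rewrite -big_distrl/= ler_wpM2r.
  rewrite big_seq [leRHS]big_seq; apply: ler_sum => c cF.
  have [_ adm sU] := hU _ cF.
  rewrite (_ : \sum_(u <- U c) _ = weight d c * \sum_(u <- U c) d ^+ (size u).+1).
    by rewrite ler_wpM2l// weight_ge0// ltW.
  rewrite big_distrr/= big_seq [RHS]big_seq; apply: eq_bigr => u /adm ad.
  case: ad => v1 x v2 h1 h2 h3 h4 h5.
  by rewrite (weight_extension v_inj aT' bT' ab (F'T _ cF) h1 h2 h3) mulrC.
Qed.

End families.

(** * Laws of the partition *)

Section current_partitions.
Context (n : nat) (I : finType) (v : I -> 'I_n).
Hypothesis v_inj : injective v.
Implicit Types (c r : current n).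

Lemma odd_sum_card (C : {set 'I_n}) (f : 'I_n -> nat) :
  odd (\sum_(x in C) f x) = odd #|[set x in C | odd (f x)]%SET|.
Proof.
have -> : #|[set x in C | odd (f x)]%SET| = (\sum_(x in C) odd (f x))%N.
  by rewrite -sum1_card big_mkcond [RHS]big_mkcond/=; apply: eq_bigr => x _;
    rewrite inE; case: (x \in C); case: (odd _).
elim/big_ind2: _ => // [a b a' b' h h'|x _]; first by rewrite !oddD h h'.
by rewrite oddb.
Qed.

(** Handshake argument: in the sum of the degrees over a cluster every open edge counts twice or not
    at all. *)
Lemma odd_card_cluster_sources c x : ~~ odd #|(Defs.cluster c x :&: sources c)%SET|.
Proof.
have -> : (Defs.cluster c x :&: sources c)%SET = [set y in Defs.cluster c x | odd (degree c y)]%SET.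
  by apply/setP => y; rewrite finset.in_setI [in RHS]finset.in_set in_sources.
rewrite -odd_sum_card /degree (exchange_big_dep xpredT)//=.
have : forall e : edge n, ~~ odd (\sum_(y in Defs.cluster c x | y \in val e) c e).
  move=> e; rewrite (eq_bigl [in (Defs.cluster c x :&: val e)%SET]); last first.
    by move=> y; rewrite /= finset.in_setI.
  rewrite sum_nat_const oddM; have [->|ce] := posnP (c e); first by rewrite andbF.
  rewrite negb_and; apply/orP; left.
  have e2 : #|val e| == 2%N by exact: (valP e).
  have /cards2P[a [b [ab eE]]] := e2.
  have abo : open_edge c a b by apply/existsP; exists e; rewrite eE eqxx.
  have abC : (a \in Defs.cluster c x) = (b \in Defs.cluster c x).
    rewrite !inE; apply/idP/idP => h; apply: (connect_trans h); apply: connect1 => //.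
    by rewrite open_edge_sym.
  case: (boolP (a \in Defs.cluster c x)) => aC.
    rewrite (finset.setIidPr _) ?(eqP e2)// eE.
    by apply/fintype.subsetP => y; rewrite finset.in_set2 => /orP[] /eqP ->; rewrite -?abC.
  rewrite (_ : (_ :&: _)%SET = finset.set0) ?cards0//.
  apply/setP => y; rewrite finset.in_setI eE finset.in_set2 finset.in_set0.
  have [->|_] := eqVneq y a; first by rewrite (negbTE aC).
  by have [->|_] := eqVneq y b; rewrite ?andbF// -abC (negbTE aC).
move=> he; apply: (big_ind (fun k => ~~ odd k)) => [//|a b /negbTE ha /negbTE hb|e _].
  by rewrite oddD ha hb.
exact: he.
Qed.

Lemma connected_in_equivalence c :
  {in [set: I]%SET & &, equivalence_rel (fun i j => connected_in c (v i) (v j))}.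
Proof.
move=> i j k _ _ _; split; first exact: connect0.
move=> ij; apply/idP/idP => h; last exact: connect_trans ij h.
by apply: connect_trans h; rewrite -/(connected_in _ _ _) connected_sym.
Qed.

Lemma even_current_partition c : sources c = marked_set v ->
  even_partitions I (current_partition v c).
Proof.
move=> sc; split; first exact/equivalence_partitionP/connected_in_equivalence.
move=> B /imsetP[i _ ->]; have := odd_card_cluster_sources c (v i).
rewrite -(card_imset _ v_inj); congr (~~ odd #|pred_of_set _|).
apply/setP => y; rewrite finset.in_setI sc; apply/andP/imsetP.
  move=> [iy /marked_setP[j yj]]; exists j => //; subst y.
  by move: iy; rewrite !inE.
move=> [j + ->]; rewrite !inE => /= h; split=> //.
by apply/marked_setP; exists j.
Qed.

Lemma current_partitionE (pi : {set {set I}}) c : finset.partition pi [set: I]%SET ->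
  (forall i j, connected_in c (v i) (v j) = (finset.pblock pi i == finset.pblock pi j)) ->
  current_partition v c = pi.
Proof.
move=> pp h; rewrite /current_partition -[RHS](equivalence_partition_pblock pp).
have [/eqP cov tI _] := and3P pp.
apply: eq_imset => i; apply/setP => j; rewrite !inE /= h.
by rewrite eq_pblock// cov inE.
Qed.

Lemma even_classes_pblock (pi : {set {set I}}) : even_partitions I pi ->
  even_classes (finset.pblock pi) [set: I]%SET.
Proof.
move=> [pp ev] l; have [/eqP cov tI _] := and3P pp.
case: (pickP (fun i => finset.pblock pi i == l)) => [i /eqP <-|no]; last first.
  by rewrite (_ : [set _ in _ | _]%SET = finset.set0) ?cards0//; apply/setP => i; rewrite !inE no.
rewrite (_ : [set _ in _ | _]%SET = finset.pblock pi i).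
  by apply: ev; rewrite pblock_mem// cov inE.
apply/setP => j; rewrite !inE /= eq_sym eq_pblock//.
by rewrite cov inE.
Qed.

Section dressed_backbones.
Context (m : nat) (Lb : eqType) (lab : I -> Lb).
Local Notation backbone := (backbone m v lab [set: I]%SET).

Lemma backbone_mark c i : backbone c -> v i \in support c.
Proof.
by move=> cT; apply: sources_support; rewrite (backbone_sources cT) imset_f ?inE.
Qed.

Lemma connected_add_backbone c r i j : backbone c ->
  (forall x, x \in support r -> x \notin support c) ->
  connected_in (current_add c r) (v i) (v j) = (lab i == lab j).
Proof.
move=> cT rc; have [col ce ci] := backbone_colour cT.
apply/idP/eqP => [h|h]; last by apply/connected_addl/(backbone_same cT); rewrite ?inE.
(* The colouring is extended by a neutral value off the backbone; it remains constant along open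
   edges of the sum because the supports are disjoint. *)
pose f x := if x \in support c then Some (col x) else None.
have fE k : f (v k) = Some (lab k) by rewrite /f backbone_mark// ci ?inE.
suff : f (v i) = f (v j) by rewrite !fE => -[].
apply: connected_invariant h => x y; rewrite open_edge_add => /orP[xy|xy]; rewrite /f.
  by rewrite (open_edge_supportl xy) (open_edge_supportr xy) (ce _ _ xy).
by rewrite !(negbTE (rc _ _)) ?(open_edge_supportl xy) ?(open_edge_supportr xy).
Qed.

(** The right-hand side depends only on the sum of the two currents, so the sum determines the
    support of the backbone. *)
Lemma support_backbone c r x : backbone c ->
  (forall x, x \in support r -> x \notin support c) ->
  (x \in support c) = [exists i, connected_in (current_add c r) (v i) x].
Proof.
move=> cT rc; apply/idP/existsP => [/(backbone_reach cT)[i _ h]|[i h]].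
  by exists i; exact: connected_addl.
suff <- : (v i \in support c) = (x \in support c) by exact: backbone_mark.
apply: (connected_invariant (f := fun y => y \in support c)) h => y z.
rewrite open_edge_add => /orP[yz|yz].
  by rewrite (open_edge_supportl yz) (open_edge_supportr yz).
by rewrite !(negbTE (rc _ _)) ?(open_edge_supportl yz) ?(open_edge_supportr yz).
Qed.

(* The backbone is the part of the current inside the clusters of the marked
   vertices. *)
Lemma backbone_add_inj c r c' r' : backbone c -> backbone c' ->
  (forall x, x \in support r -> x \notin support c) ->
  (forall x, x \in support r' -> x \notin support c') ->
  current_add c r = current_add c' r' -> c = c'.
Proof.
move=> cT cT' rc rc' E.
have S : support c = support c'.
  by apply/setP => x; rewrite (support_backbone x cT rc) (support_backbone x cT' rc') E.
have r0 (e : edge n) s : (forall x, x \in support s -> x \notin support c) ->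
    (0 < c e)%N || (0 < c' e)%N -> s e = 0%N.
  move=> sc ce; apply/eqP; rewrite eqn0Ngt; apply/negP => se.
  have : (0 < #|val e|)%N by rewrite (eqP (valP e)).
  move=> /card_gt0P[x xe].
  have xs : x \in support s by apply/in_supportP; exists e.
  have := sc _ xs; apply/negP; rewrite negbK.
  case/orP: ce => ce; first by apply/in_supportP; exists e.
  by rewrite S; apply/in_supportP; exists e.
apply/ffunP => e; have : (c e + r e = c' e + r' e)%N.
  by have /ffunP/(_ e) := E; rewrite !ffunE.
case: (boolP ((0 < c e)%N || (0 < c' e)%N)) => [ce|].
  by rewrite (r0 e r)// (r0 e r')// ?addn0// S.
by rewrite negb_or -!leqNgt !leqn0 => /andP[/eqP -> /eqP ->].
Qed.

End dressed_backbones.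
End current_partitions.

(** * From spin sums to current measures *)

Section current_measures.
Context (R : realType) (n : nat) (d : R).
Hypothesis d0 : 0 <= d.
Local Notation edges := [set: edge n]%SET.
Implicit Types (c r : current n) (S : {set 'I_n}) (A : set (current n)).

Lemma parity_match_in_exp S c : parity_match (in_exp S) c = (sources c == S).
Proof.
apply/forallP/eqP => [h|<- x]; last by rewrite oddD /in_exp in_sources oddb addbb.
by apply/setP => x; have := h x; rewrite oddD /in_exp in_sources oddb; case: (odd _); case: (_ \in _).
Qed.

Lemma parity_match0 c : parity_match (fun=> 0%N) c = (sources c == finset.set0).
Proof.
rewrite -parity_match_in_exp /parity_match; apply: eq_forallb => x.
by rewrite /in_exp finset.in_set0.
Qed.

Lemma supported_edges c : supported edges c.
Proof. by apply/forallP => e; rewrite inE. Qed.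

(** Adding [c] is injective and multiplies weights when no edge is shared. Finite boxes give the
    bound for truncations, which then passes to the limit. *)
Lemma spin_sum_le_esum_shift Es k A c :
  (forall r, supported Es r -> parity_match k r -> A (current_add c r)) ->
  (forall r, supported Es r -> forall e, (c e == 0)%N || (r e == 0)%N) ->
  ((weight d c * spin_sum d Es k)%:E <= \esum_(m in A) (Num.max (weight d m) 0)%:E)%E.
Proof.
move=> AP dis.
have addI : injective (current_add c).
  by move=> r r'; rewrite ![current_add c _]current_addC; exact: current_addIr.
have leN N : ((weight d c * \sum_(r <- box Es k N) weight d r)%:E <=
    \esum_(m in A) (Num.max (weight d m) 0)%:E)%E.
  apply: esum_ge; exists [set` [seq current_add c r | r <- box Es k N]].
    split; first exact: finite_seq.
    by move=> m /= /mapP[r]; rewrite mem_box => /and3P[? ? _] ->; exact: AP.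
  have uq : uniq [seq current_add c r | r <- box Es k N] by rewrite map_inj_uniq ?box_uniq.
  rewrite -fsbig_seq// sumEFin lee_fin [leRHS]big_map big_distrr/=.
  rewrite [leLHS]big_seq [leRHS]big_seq.
  apply: ler_sum => r.
  rewrite mem_box => /and3P[sr _ _]; rewrite max_weight// weight_add//; exact: dis.
case eA : (\esum_(m in A) _)%E leN => [r| |] leN; last 2 first.
- by rewrite leey.
- by have := leN 0%N.
have cvgw : (fun N => weight d c * \sum_(r <- box Es k N) weight d r) @ \oo -->
    weight d c * spin_sum d Es k.
  apply: cvgM; first exact: cvg_cst.
  rewrite (funext (sum_box d Es k)).
  exact: cvg_trunc_spin_sum.
rewrite lee_fin -(cvg_lim _ cvgw)//; apply: limr_le; first by apply/cvg_ex; eexists; exact: cvgw.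
by apply: nearW => N; rewrite -lee_fin.
Qed.

Lemma spin_sum_le_esum Es k A :
  (forall m, supported Es m -> parity_match k m -> A m) ->
  ((spin_sum d Es k)%:E <= \esum_(m in A) (Num.max (weight d m) 0)%:E)%E.
Proof.
move=> AP; rewrite -[spin_sum _ _ _]mul1r -(weight0 n d).
by apply: spin_sum_le_esum_shift => r sr; [rewrite current_add0; exact: AP|move=> e; rewrite ffunE].
Qed.

(** The total mass is finite, so [mnormalize] avoids its default value as soon as the spin sum is
    positive. *)
Lemma current_measure_setT S :
  current_measure d S [set: current n] = (spin_sum d edges (in_exp S))%:E.
Proof.
apply/eqP; rewrite eq_le /current_measure setTI; apply/andP; split.
  apply: (esum_le_spin_sum d0) => c /= sc.
  by rewrite supported_edges parity_match_in_exp sc eqxx.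
apply: spin_sum_le_esum => c _; rewrite parity_match_in_exp => /eqP; exact.
Qed.

Lemma current_lawE S A : 0 < spin_sum d edges (in_exp S) ->
  current_law d S A = (current_measure d S A * (spin_sum d edges (in_exp S))^-1%:E)%E.
Proof.
by move=> Z0; rewrite /current_law /= /mnormalize /= current_measure_setT eqe gt_eqF.
Qed.

Lemma current_law_sources S : 0 < spin_sum d edges (in_exp S) ->
  forall A, (forall c, A c -> sources c != S) -> current_law d S A = 0%E.
Proof.
move=> Z0 A AS; rewrite current_lawE// /current_measure.
rewrite (_ : A `&` _ = set0) ?esum_set0 ?mul0e//.
by apply/seteqP; split=> // c [/AS/eqP].
Qed.

Section around_backbone.
Context (I : finType) (v : I -> 'I_n) (m : nat) (Lb : eqType) (lab : I -> Lb).
Variable c : current n.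
Hypothesis cT : backbone m v lab [set: I]%SET c.

Definition off_support : {set edge n} := [set e : edge n | [disjoint val e & support c]]%SET.

Definition dressings : set (current n) :=
  [set r | supported off_support r && parity_match (fun=> 0%N) r].

Definition dressed : set (current n) := [set current_add c r | r in dressings].

Lemma supported_off r : supported off_support r ->
  forall x, x \in support r -> x \notin support c.
Proof.
move=> /forallP sr x /in_supportP[e xe re]; have := sr e.
case: (boolP (e \in off_support)) => [|_ /=]; last by rewrite gtn_eqF.
by rewrite inE => /pred0P/(_ x) /=; rewrite xe /= => ->.
Qed.

Lemma dressings_law : 
  ((spin_sum d off_support (fun=> 0%N))%:E <= current_measure d finset.set0 dressings)%E.
Proof.
apply: spin_sum_le_esum => r sr pr; split; first by rewrite /dressings /= sr pr.
by apply/eqP; rewrite -parity_match0.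
Qed.

Lemma dressed_measure :
  ((weight d c * spin_sum d off_support (fun=> 0%N))%:E <=
    current_measure d (marked_set v) dressed)%E.
Proof.
apply: spin_sum_le_esum_shift => r sr.
  move=> pr; split; first by exists r => //=; rewrite /dressings /= sr pr.
  apply/setP => x; rewrite in_sources_add.
  have /eqP -> : sources r == finset.set0 by rewrite -parity_match0.
  rewrite finset.in_set0 addbF (backbone_sources cT).
  by apply/imsetP/marked_setP => [[i _ ->]|[i ->]]; exists i.
move=> e; case: (posnP (c e)) => [//|ce]; case: (posnP (r e)) => [_|re]; first by rewrite orbT.
have : (0 < #|val e|)%N by rewrite (eqP (valP e)).
move=> /card_gt0P[x xe]; have xr : x \in support r by apply/in_supportP; exists e.
have /negP[] := supported_off sr xr.
by apply/in_supportP; exists e.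
Qed.

End around_backbone.

Lemma sum_measure_disjoint_le (dT : measure_display) (T : measurableType dT)
    (mu : {measure set T -> \bar R}) (X : eqType) (s : seq X) (G : X -> set T) (E : set T) :
  uniq s -> measurable E -> (forall x, x \in s -> measurable (G x)) ->
  (forall x, x \in s -> G x `<=` E) ->
  (forall x y, x \in s -> y \in s -> G x `&` G y !=set0 -> x = y) ->
  (\sum_(x <- s) mu (G x) <= mu E)%E.
Proof.
elim: s E => [|x s ih] E; first by rewrite big_nil.
rewrite cons_uniq => /andP[xs us] mE mG GE Gd; rewrite big_cons.
have xh := mem_head x s.
rewrite -(setDUK (GE x xh)) measureU//; last 3 first.
- exact: mG.
- by apply: measurableD => //; exact: mG.
- by rewrite setDIK.
rewrite leeD2l//; apply: ih => //.
- by apply: measurableD => //; exact: mG.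
- by move=> y ys; apply: mG; rewrite inE ys orbT.
- move=> y ys z Gyz; split; first by apply: GE Gyz; rewrite inE ys orbT.
  move=> Gxz; move: xs; rewrite (Gd x y) ?ys// ?inE ?ys ?orbT//.
  by exists z.
- by move=> y z ys zs; apply: Gd; rewrite inE ?ys ?zs orbT.
Qed.

End current_measures.

(** * Probabilities of even and of other partitions *)

Section law_bounds.
Context (R : realType).
Local Notation edges n := [set: edge n]%SET.

Lemma measurable_current_pair n (A : set (current n * current n)) : measurable A.
Proof.
apply: countable_measurable => [m|]; last first.
  exact: sub_countable (subset_card_le (@subsetT _ _)) (countableP _).
have -> : [set m] = [set m.1] `*` [set m.2].
  by apply/seteqP; split=> [_ ->//|[a b] [/= -> ->]]; case: m.
exact: measurableX.
Qed.

Lemma in_exp_set0 n : in_exp (finset.set0 : {set 'I_n}) = fun=> 0%N.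
Proof. by apply/funext => x; rewrite /in_exp finset.in_set0. Qed.

Section partition_events.
Context (n : nat) (I : finType) (v : I -> 'I_n) (pi : {set {set I}}).

Definition partition_event : set (current n) := [set c | current_partition v c = pi].

Definition partition_event2 : set (current n * current n) :=
  [set c | current_partition v (current_add c.1 c.2) = pi].

Context (m : nat).
Hypothesis (v_inj : injective v) (pi_even : even_partitions I pi).
Local Notation bb := (backbone m v (finset.pblock pi) [set: I]%SET).

Lemma dressed_sub c : bb c -> dressed c `<=` partition_event.
Proof.
move=> cT _ [r /= /andP[sr _] <-]; apply: current_partitionE; first by case: pi_even.
by move=> i j; apply: connected_add_backbone cT _; exact: supported_off.
Qed.

Lemma dressed_sub2 c : bb c -> dressed c `*` dressings c `<=` partition_event2.
Proof.
move=> cT [_ r'] [/= [r /= /andP[sr _] <-] /andP[sr' _]].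
apply: current_partitionE; first by case: pi_even.
move=> i j; rewrite -current_addA; apply: connected_add_backbone cT _ => x.
by rewrite support_add finset.in_setU => /orP[]; exact: supported_off.
Qed.

Lemma dressed_disjoint c c' : bb c -> bb c' -> dressed c `&` dressed c' !=set0 -> c = c'.
Proof.
move=> cT cT' [_ [[r /= /andP[sr _] <-] [r' /= /andP[sr' _] E]]].
by apply: (backbone_add_inj cT cT') (esym E); exact: supported_off.
Qed.

End partition_events.

(** The dressed events of distinct backbones are disjoint. Their total mass is at least of order
    $m^{-k}$ times the sourceless partition function, which is also the order of the upper bound for
    $Z^S$. *)
Lemma partition_law_lower (L : R) (k : nat) : 0 <= L ->
  exists2 delta, 0 < delta & exists m0, forall n m d (I : finType) (v : I -> 'I_n) pi,
    injective v -> #|I| = k.*2 -> critical_window L n m d -> (m0 <= m)%N ->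
    even_partitions I pi ->
    [/\ 0 < spin_sum d (edges n) (in_exp (marked_set v)),
     (delta%:E <= current_law d (marked_set v) (partition_event v pi))%E &
     (delta%:E <= (current_law d (marked_set v) \x current_law d finset.set0)
        (partition_event2 v pi))%E].
Proof.
move=> L0.
have [kp kp0 [m1 hF]] := backbone_family k.*2 L0.
(* A backbone for $2k$ marks has at most $2k \cdot 2m = 4km$ vertices. *)
have [c2' c2'0 hoff'] := @spin_sum_off_lower R L (4 * k) L0.
have [C C0 hS] := spin_sum_sources_le k L0.
(* Capping at 1 makes [delta1 * c2] at most [delta1], so one constant serves the single and the
   double current. *)
pose c2 := Num.min c2' 1.
have c20 : 0 < c2 by rewrite lt_min c2'0 ltr01.
have c21 : c2 <= 1 by rewrite ge_min lexx orbT.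
pose delta1 := kp ^+ k * c2 / C.
have delta10 : 0 < delta1 by rewrite divr_gt0// mulr_gt0// exprn_gt0.
exists (delta1 * c2); first by rewrite mulr_gt0.
exists (maxn m1 (4 * k + 4)) => n m d I v pi v_inj Ik W; rewrite geq_max => /andP[mm1 mk] pi_even.
have [_ mn _ _ _] := W.
have n4k : (4 * k <= n)%N by nia.
have n4 : (4 <= n)%N by nia.
have d0 := window_d_gt0 W; have d0' := ltW d0.
have [F [uF FT sF]] := hF n m d I v _ (finset.pblock pi) finset.set0 k [set: I]%SET
  v_inj (eq_leq Ik) W mm1 (etrans (cardsT I) Ik) (even_classes_pblock pi_even).
pose S := marked_set v.
have Sk : #|S| = k.*2 by rewrite -Ik /S /marked_set card_imset.
pose Z := spin_sum d (edges n) (fun=> 0%N).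
have Z0 : 0 < Z by exact: spin_sum0_gt0.
pose ZS := spin_sum d (edges n) (in_exp S).
have hoff c : c \in F -> c2 * Z <= spin_sum d (off_support c) (fun=> 0%N).
  move=> /FT cT; apply: (@le_trans _ _ (c2' * Z)).
    by rewrite ler_pM2r// ge_min lexx.
  apply: (hoff' n m) => //; apply: leq_trans (backbone_card cT) _.
  by rewrite cardsT Ik; lia.
have dm c : c \in F -> ((weight d c * (c2 * Z))%:E <= current_measure d S (dressed c))%E.
  move=> cF; apply: le_trans (dressed_measure d0' (FT _ cF)).
  by rewrite lee_fin ler_wpM2l ?weight_ge0// hoff.
have dis c c' : c \in F -> c' \in F -> dressed c `&` dressed c' !=set0 -> c = c'.
  by move=> cF cF'; apply: dressed_disjoint; exact: FT.
have m_gt0 : 0 < m%:R :> R by rewrite ltr0n; exact: window_m_gt0 W.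
have km0 : 0 < (kp / m%:R) ^+ k by rewrite exprn_gt0// divr_gt0.
(* Positivity of $Z^S$ comes from the backbones themselves, whose dressed events have positive
   mass. *)
have ZS0 : 0 < ZS.
  rewrite -lte_fin -(current_measure_setT d0').
  apply: lt_le_trans (_ : (\sum_(c <- F) current_measure d S (dressed c) <= _)%E); last first.
    exact: (sum_measure_disjoint_le (current_measure d S)).
  apply: (@lt_le_trans _ _ (\sum_(c <- F) (weight d c * (c2 * Z))%:E)%E).
    rewrite sumEFin lte_fin -big_distrl/= mulr_gt0//; last exact: mulr_gt0.
    exact: lt_le_trans sF.
  by rewrite big_seq [leRHS]big_seq; apply: lee_sum => c; exact: dm.
have pS c : c \in F -> ((weight d c * (c2 * Z / ZS))%:E <= current_law d S (dressed c))%E.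
  move=> cF; rewrite current_lawE// mulrA EFinM lee_pmul2r ?lte_fin ?invr_gt0//.
  exact: dm.
have p0 c : c \in F -> (c2%:E <= current_law d finset.set0 (dressings c))%E.
  move=> cF; rewrite current_lawE ?in_exp_set0// -/Z.
  rewrite -[X in (X <= _)%E]mule1 -[1%E]/(1%:E) -(mulfV (lt0r_neq0 Z0)) -EFinM mulrA EFinM.
  rewrite lee_pmul2r ?lte_fin ?invr_gt0//.
  by apply: le_trans (dressings_law d0' c); rewrite lee_fin hoff.
have q0 : 0 <= c2 * Z / ZS by apply: divr_ge0; [apply: mulr_ge0|]; exact: ltW.
have sum_ge : delta1 <= \sum_(c <- F) weight d c * (c2 * Z / ZS).
  rewrite -big_distrl/=.
  apply: (@le_trans _ _ ((kp / m%:R) ^+ k * (c2 * Z / ZS))); last first.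
    by rewrite ler_wpM2r.
  have ZSle : ZS <= C / m%:R ^+ k * Z by exact: (hS n m).
  apply: (@le_trans _ _ ((kp / m%:R) ^+ k * (c2 * Z / (C / m%:R ^+ k * Z)))).
    rewrite exprMn exprVn le_eqVlt; apply/orP; left; apply/eqP.
    rewrite /delta1; move: (m%:R ^+ k) (exprn_gt0 k m_gt0) (kp ^+ k) => a a0 b.
    by field; rewrite !gt_eqF.
  apply: ler_wpM2l; first exact: ltW.
  apply: ler_wpM2l; first by apply: mulr_ge0; exact: ltW.
  rewrite lef_pV2// posrE; apply: mulr_gt0 => //; apply: divr_gt0 => //.
  exact: exprn_gt0.
split=> //.
- apply: (@le_trans _ _ delta1%:E).
    by rewrite lee_fin ler_piMr// ltW.
  apply: (@le_trans _ _ (\sum_(c <- F) (weight d c * (c2 * Z / ZS))%:E)%E).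
    by rewrite sumEFin lee_fin.
  apply: (@le_trans _ _ (\sum_(c <- F) current_law d S (dressed c))%E).
    by rewrite big_seq [leRHS]big_seq; apply: lee_sum => c; exact: pS.
  apply: (sum_measure_disjoint_le (current_law d S)) => // c cF.
  by apply: (@dressed_sub _ _ _ _ m) => //; exact: FT.
(* For the double current the second, independent current avoids the backbone with probability at
   least [c2]. *)
- apply: (@le_trans _ _ (\sum_(c <- F) (weight d c * (c2 * Z / ZS) * c2)%:E)%E).
    by rewrite sumEFin lee_fin -big_distrl/= ler_pM2r.
  apply: (@le_trans _ _ (\sum_(c <- F)
     (current_law d S \x current_law d finset.set0) (dressed c `*` dressings c))%E).
    rewrite big_seq [leRHS]big_seq; apply: lee_sum => c cF.
    rewrite product_measure1E// EFinM; apply: lee_pmul.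
    + by rewrite lee_fin mulr_ge0 ?weight_ge0.
    + by rewrite lee_fin ltW.
    + exact: pS.
    + exact: p0.
  apply: (sum_measure_disjoint_le (current_law d S \x current_law d finset.set0)%E) => //.
  + exact: measurable_current_pair.
  + by move=> c cF; exact: measurable_current_pair.
  + by move=> c cF; apply: (@dressed_sub2 _ _ _ _ m) => //; exact: FT.
  + move=> c c' cF cF' [[x y] [[/= xc _] [/= xc' _]]]; apply: dis => //.
    by exists x.
Qed.

Lemma partition_law_zero n (I : finType) (v : I -> 'I_n) pi (d : R) : injective v ->
  0 < d -> 0 < spin_sum d (edges n) (in_exp (marked_set v)) ->
  ~ even_partitions I pi ->
  current_law d (marked_set v) (partition_event v pi) = 0%E /\
  (current_law d (marked_set v) \x current_law d finset.set0)%E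
        (partition_event2 v pi) = 0%E.
Proof.
move=> v_inj d0 ZS0 npi; have d0' := ltW d0.
split.
  apply: current_law_sources => // c cpi; apply/negP => /eqP sc.
  by apply: npi; rewrite -cpi; exact: even_current_partition.
pose B := [set c : current n | sources c != marked_set v].
pose B' := [set c : current n | sources c != finset.set0].
(* If both source sets are correct, the sum has source set $S$ and parity forces an even partition;
   the event is thus covered by two null sets. *)
have sub : partition_event2 v pi `<=` (B `*` [set: current n]) `|` ([set: current n] `*` B').
  move=> [c r] /= cpi; rewrite /B /B' /=.
  case: (eqVneq (sources c) (marked_set v)) => [sc|]; last by left.
  case: (eqVneq (sources r) finset.set0) => [sr|]; last by right.
  exfalso; apply: npi; rewrite -cpi; apply: even_current_partition => //.
  by apply/setP => x; rewrite in_sources_add sc sr finset.in_set0 addbF.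
have PB : current_law d (marked_set v) B = 0%E by exact: current_law_sources.
have PB' : current_law d (finset.set0 : {set 'I_n}) B' = 0%E.
  by apply: current_law_sources => //; rewrite in_exp_set0 spin_sum0_gt0.
have PB1 : (current_law d (marked_set v) \x
    current_law d (finset.set0 : {set 'I_n}))%E (B `*` [set: current n]) = 0%E.
  rewrite product_measure1E//; apply/eqP; rewrite mule_eq0; apply/orP; left; exact/eqP/PB.
have PB2 : (current_law d (marked_set v) \x
    current_law d (finset.set0 : {set 'I_n}))%E ([set: current n] `*` B') = 0%E.
  rewrite product_measure1E//; apply/eqP; rewrite mule_eq0; apply/orP; right; exact/eqP/PB'.
apply/eqP; rewrite eq_le measure_ge0 andbT.
apply: (@le_trans _ _ ((current_law d (marked_set v) \x current_law d (finset.set0 : {set 'I_n}))%E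
   ((B `*` [set: current n]) `|` ([set: current n] `*` B')))).
  by apply: le_measure => //; rewrite inE; exact: measurable_current_pair.
rewrite -[leRHS]adde0 -{1}PB1 -PB2; apply: measureU2; exact: measurable_current_pair.
Qed.

End law_bounds.

(** * The limit in distribution *)

Section scaling_window.
Context (R : realType).

Lemma exists_floor_sqrt (n : nat) : exists m, (m ^ 2 <= n < m.+1 ^ 2)%N.
Proof.
elim: n => [|n [m /andP[h1 h2]]]; first by exists 0%N.
have [h|h] := leqP (m.+1 ^ 2) n.+1; last by exists m; rewrite h andbT leqW.
by exists m.+1; rewrite h /=; move: h1 h2; rewrite !expnS !expn0; nia.
Qed.

(** With [m] the integer part of $\sqrt n$, the deviation $|1 - dn| = |\lambda|/\sqrt n$ is at most
    $|\lambda|/m$, and at most $1/2$ once [m] exceeds $2|\lambda|$. *)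
Lemma critical_window_dens (lambda : R) (k m0 : nat) :
  exists l0, forall l, (l0 <= l)%N -> exists2 m, (m0 <= m)%N &
    critical_window `|lambda| (2 * k + l) m (dens lambda k l).
Proof.
pose M := (maxn m0 (Num.bound (2 * `|lambda|))).+1.
exists (M ^ 2)%N => l lM; set n := (2 * k + l)%N.
have nM : (M ^ 2 <= n)%N by apply: leq_trans lM _; rewrite leq_addl.
have [m /andP[mn nm]] := exists_floor_sqrt n.
have Mm : (M <= m)%N by rewrite leqNgt; apply/negP => h; move: nm nM h; rewrite !expnS !expn0; nia.
exists m; first by apply: leq_trans Mm; rewrite /M leqW// leq_maxl.
have m_gt0 : (0 < m)%N by apply: leq_trans Mm.
have mR0 : 0 < m%:R :> R by rewrite ltr0n.
have n_gt0 : (0 < n)%N by apply: leq_trans mn; rewrite expn_gt0 m_gt0.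
have nR0 : 0 < n%:R :> R by rewrite ltr0n.
have s0 : 0 < Num.sqrt n%:R :> R by rewrite sqrtr_gt0.
have ms : m%:R <= Num.sqrt n%:R :> R.
  rewrite -[leLHS]ger0_norm ?ler0n// -sqrtr_sqr ler_wsqrtr//.
  by rewrite -natrX ler_nat.
have dnE : dens lambda k l * n%:R = 1 - lambda / Num.sqrt n%:R.
  by rewrite /dens -/n mulrAC mulVf ?mul1r// gt_eqF.
have eps : `|1 - dens lambda k l * n%:R| <= `|lambda| / m%:R.
  rewrite dnE opprB addrC subrK normrM normfV (gtr0_norm s0).
  by rewrite ler_wpM2l// lef_pV2.
have half : `|lambda| / m%:R <= 2^-1.
  have := archi_boundP (mulr_ge0 (ler0n R 2) (normr_ge0 lambda)).
  move=> /ltW h; rewrite ler_pdivrMr//.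
  have : (Num.bound (2 * `|lambda|))%:R <= m%:R :> R.
    rewrite ler_nat; apply: leq_trans Mm; rewrite /M leqW// leq_maxr//.
  by move: h; lra.
split=> //.
- by move: nm m_gt0; rewrite !expnS !expn0; nia.
- have := le_trans eps half; rewrite ler_norml => /andP[]; lra.
Qed.

End scaling_window.

(** * Passage to the limit law *)

Section limits.
Context (R : realType) (T : ptopologicalType) (I : finType).
Local Notation PS := (partition_space I).

Lemma continuous_partition (U : topologicalType) (f : PS -> U) : continuous f.
Proof.
move=> x A Ax; apply: (filterS _ (discrete_set1 x)) => _ ->; exact: nbhs_singleton Ax.
Qed.

Lemma measurable_snd_partition (pi : PS) :
  measurable [set z : borel (T * PS)%type | z.2 = pi].
Proof.
apply: sub_sigma_algebra => /=.
have : continuous (snd : T * PS -> PS) by move=> z; exact: cvg_snd.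
move=> /continuousP/(_ [set pi]); apply; exact: discrete_open.
Qed.

(** The indicator of a single partition is a bounded continuous test function because the space of
    partitions is discrete. *)
Lemma cvg_law_partition (d : measure_display) (Om : nat -> measurableType d)
    (P : forall n, probability (Om n) R) (X : forall n, {RV (P n) >-> borel (T * PS)%type})
    (d' : measure_display) (Om' : measurableType d') (Q : probability Om' R)
    (Y : {RV Q >-> borel (T * PS)%type}) (pi : PS) :
  cvg_in_distribution X Y ->
  (fun n => P n [set w | (X n w).2 = pi]) @ \oo --> distribution Q (snd_rv Y) [set pi].
Proof.
move=> XY; pose f (z : T * PS) : R := (z.2 == pi)%:R.
have cf : continuous f.
  move=> z; apply: (cvg_comp snd (fun p : PS => (p == pi)%:R : R) (G := nbhs z.2)).
    exact: cvg_snd.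
  exact: continuous_partition.
have bf : exists M, forall z, `|f z| <= M.
  by exists 1 => z; rewrite /f; case: (_ == _); rewrite ?normr1 ?normr0.
have E (dd : measure_display) (O : measurableType dd) (P' : probability O R)
    (X' : {RV P' >-> borel (T * PS)%type}) :
    expectation P' (fun w => f (X' w)) = P' [set w | (X' w).2 = pi].
  rewrite -(@expectation_indic _ _ _ P'); last first.
    rewrite (_ : [set w | _] = X' @^-1` [set z | z.2 = pi])//.
    rewrite -[X in measurable X]setTI; apply: measurable_funP => //.
    exact: measurable_snd_partition.
  congr expectation; apply/funext => w; rewrite indicE /f; congr (_%:R).
  by congr nat_of_bool; apply/eqP/idP => [h|]; rewrite ?inE// => /set_mem.
have := XY f cf bf; rewrite E.
by under eq_fun do rewrite E.
Qed.

(** A lower bound uniform in the index survives in the limit, and so does eventual vanishing. *)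
Lemma discrete_support_limit (d : measure_display) (Om : nat -> measurableType d)
    (P : forall n, probability (Om n) R) (X : forall n, {RV (P n) >-> borel (T * PS)%type})
    (d' : measure_display) (Om' : measurableType d') (Q : probability Om' R)
    (Y : {RV Q >-> borel (T * PS)%type}) (A : set PS) (delta : R) (l0 : nat) :
  cvg_in_distribution X Y -> 0 < delta ->
  (forall pi l, (l0 <= l)%N -> A pi -> (delta%:E <= P l [set w | (X l w).2 = pi])%E) ->
  (forall pi l, (l0 <= l)%N -> ~ A pi -> P l [set w | (X l w).2 = pi] = 0%E) ->
  discrete_support (snd_rv Y) = A.
Proof.
move=> XY delta0 low zero; apply/seteqP; split=> pi; rewrite /discrete_support /=.
  move=> pos; apply: contrapT => npi; move: pos.
  have c := cvg_law_partition (pi := pi) XY.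
  apply/negP; rewrite -leNgt; apply: (cvge_to_le c); exists l0 => // l /= l0l.
  by rewrite zero.
move=> piA; have c := cvg_law_partition (pi := pi) XY.
apply: (@lt_le_trans _ _ delta%:E); first by rewrite lte_fin.
by apply: (cvge_to_ge c); exists l0 => // l /= l0l; exact: low.
Qed.

End limits.

Theorem corollary1p4 (R : realType) (lambda : R) (k : nat) (k_gt0 : (0 < k)%N)
  (ds : measure_display) (Oms : measurableType ds) (Qs : probability Oms R)
  (Xs : {RV Qs >->
    borel ('rV[R]_(2 * k) * partition_space 'I_(2 * k))%type})
  (dd : measure_display) (Omd : measurableType dd) (Qd : probability Omd R)
  (Xd : {RV Qd >->
    borel ('rV[R]_(2 * k) * partition_space 'I_(2 * k))%type})
  (cvg_Xs : cvg_in_distribution (P := single_law lambda k)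
     (fun l => single_rv (clusters_and_partition R (k := k) (l := l))) Xs)
  (cvg_Xd : cvg_in_distribution (P := double_law lambda k)
     (fun l => double_rv (clusters_and_partition R (k := k) (l := l))) Xd) :
  [/\ cvg_in_distribution (P := single_law lambda k)
        (fun l => single_rv (partition_of (k := k) (l := l))) (snd_rv Xs),
      cvg_in_distribution (P := double_law lambda k)
        (fun l => double_rv (partition_of (k := k) (l := l))) (snd_rv Xd),
      discrete_support (snd_rv Xs) = even_partitions 'I_(2 * k) &
      discrete_support (snd_rv Xd) = even_partitions 'I_(2 * k)].
Proof.
have [delta delta0 [m0 lower]] := partition_law_lower k (normr_ge0 lambda).
have [l0 window] := critical_window_dens lambda k m0.
have mark_inj l : injective (@mark k l) by exact: lshift_inj.
have I2k : #|'I_(2 * k)| = k.*2 by rewrite card_ord mul2n.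
(* The one-block partition is even. It serves to obtain $Z^S > 0$ from the lower bound when the
   partition under study is not even. *)
have [pi0 pi0_even] : exists pi : {set {set 'I_(2 * k)}}, even_partitions 'I_(2 * k) pi.
  exists [set [set: 'I_(2 * k)]]%SET; split.
    apply/and3P; split; first by rewrite /finset.cover big_set1.
      by apply/finset.trivIsetP => A B; rewrite !finset.in_set1 => /eqP -> /eqP ->; rewrite eqxx.
    by rewrite finset.in_set1 eq_sym -card_gt0 cardsT card_ord muln_gt0.
  by move=> B; rewrite finset.in_set1 => /eqP ->; rewrite cardsT I2k odd_double.
split.
(* A test function on partitions is composed with the projection. *)
- move=> f cf bf; apply: (cvg_Xs (fun z => f z.2)).
    by move=> z; apply: (cvg_comp snd f (G := nbhs z.2)); [exact: cvg_snd|exact: cf].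
  by have [M fM] := bf; exists M.
- move=> f cf bf; apply: (cvg_Xd (fun z => f z.2)).
    by move=> z; apply: (cvg_comp snd f (G := nbhs z.2)); [exact: cvg_snd|exact: cf].
  by have [M fM] := bf; exists M.
- apply: (discrete_support_limit (l0 := l0) cvg_Xs delta0) => pi l l0l pi_even;
    have [m mm W] := window l l0l.
    by have [] := lower _ _ _ _ _ _ (mark_inj l) I2k W mm pi_even.
  have [ZS _ _] := lower _ _ _ _ _ _ (mark_inj l) I2k W mm pi0_even.
  by have [] := partition_law_zero (mark_inj l) (window_d_gt0 W) ZS pi_even.
- apply: (discrete_support_limit (l0 := l0) cvg_Xd delta0) => pi l l0l pi_even;
    have [m mm W] := window l l0l.
    by have [] := lower _ _ _ _ _ _ (mark_inj l) I2k W mm pi_even.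
  have [ZS _ _] := lower _ _ _ _ _ _ (mark_inj l) I2k W mm pi0_even.
  by have [] := partition_law_zero (mark_inj l) (window_d_gt0 W) ZS pi_even.
Qed.
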